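(* Let $K$ be a field, $S=K[x_1,\ldots,x_n]$, and let $I\subset S$ be a transversal polymatroidal ideal. Then $\operatorname{depth} S/I=\operatorname{depth} S/I^k$ for all $k\geq1$. In particular, $\operatorname{depth} S/I=\lim_{k\to\infty}\operatorname{depth} S/I^k$ and $\ell(I)=n-\operatorname{depth} S/I$.
   Context: For a non-empty subset $F\subset[n]=\{1,\ldots,n\}$, $P_F=(x_i : i\in F)$. A transversal polymatroidal ideal is an ideal of the form $I=P_{F_1}\cdots P_{F_r}$, where $r\ge1$ and $F_1,\ldots,F_r$ is a collection of non-empty, not necessarily distinct, subsets of $[n]$. Depth is with respect to $\mathfrak m=(x_1,\ldots,x_n)$. The analytic spread $\ell(I)$ is the Krull dimension of the fiber ring $\mathcal R(I)/\mathfrak m\mathcal R(I)$, where $\mathcal R(I)=\bigoplus_{k\ge0}I^kt^k$ is the Rees algebra of $I$. *)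

(* Defs.v *)
From HB Require Import structures.
From mathcomp Require Import all_boot all_order all_algebra.
From mathcomp Require Import generic_quotient ring_quotient.
From mathcomp Require Import mpoly.
From mathcomp Require Import boolp.
From mathcomp Require classical_sets.

Set Implicit Arguments.
Unset Strict Implicit.
Unset Printing Implicit Defensive.

Import GRing.Theory.
Local Open Scope ring_scope.
Local Open Scope quotient_scope.

(* Ideals of a commutative ring, the unit ideal included (the library's       *)
(* [idealr] are proper ideals).                                               *)
HB.mixin Record isAbsorbing (R : comNzRingType) (S : R -> bool) := {
  absorbing_subproof : forall a, {in S, forall u, a * u \in S}
}.

#[short(type="ideal")]
HB.structure Definition Ideal (R : comNzRingType) :=
  {S of GRing.ZmodClosed R S & isAbsorbing R S}.

Section IdealOperations.
Variable R : comNzRingType.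
Implicit Types I J : ideal R.

Lemma ideal_absorb I (a u : R) : u \in I -> a * u \in I.
Proof. exact: absorbing_subproof. Qed.

Definition ideal_gen (G : {pred R}) : {pred R} :=
  [pred x | `[< exists s : seq (R * R),
      (forall c, c \in s -> c.2 \in G) /\ x = \sum_(c <- s) c.1 * c.2 >]].

Lemma ideal_gen_zmod G : zmod_closed (ideal_gen G).
Proof.
split=> [|x y].
  by apply/asboolP; exists [::]; rewrite big_nil.
move=> /asboolP[s [sG ->]] /asboolP[t [tG ->]]; apply/asboolP.
exists (s ++ [seq (- c.1, c.2) | c <- t]); split=> [c|].
  rewrite mem_cat => /orP[/sG //|/mapP[d dt ->]]; exact: (tG d).
rewrite big_cat big_map /= -sumrN; congr (_ + _).
by apply: eq_bigr => c _; rewrite mulNr.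
Qed.

Lemma ideal_gen_absorb G a : {in ideal_gen G, forall u, a * u \in ideal_gen G}.
Proof.
move=> u /asboolP[s [sG ->]]; apply/asboolP.
exists [seq (a * c.1, c.2) | c <- s]; split=> [c /mapP[d ds ->]|].
  exact: (sG d).
by rewrite big_map mulr_sumr; apply: eq_bigr => c _; rewrite mulrA.
Qed.

HB.instance Definition _ G :=
  GRing.isZmodClosed.Build R (ideal_gen G) (ideal_gen_zmod G).
HB.instance Definition _ G :=
  isAbsorbing.Build R (ideal_gen G) (@ideal_gen_absorb G).

Definition full_ideal : {pred R} := predT.

Lemma full_ideal_zmod : zmod_closed full_ideal. Proof. by []. Qed.
Lemma full_ideal_absorb a :
  {in full_ideal, forall u, a * u \in full_ideal}.
Proof. by []. Qed.

HB.instance Definition _ :=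
  GRing.isZmodClosed.Build R full_ideal full_ideal_zmod.
HB.instance Definition _ := isAbsorbing.Build R full_ideal full_ideal_absorb.

Definition ideal_mul I J : ideal R :=
  ideal_gen [pred x | `[< exists a b, [/\ a \in I, b \in J & x = a * b] >]].

Fixpoint ideal_exp I k : ideal R :=
  if k is k'.+1 then ideal_mul I (ideal_exp I k') else full_ideal.

Lemma ideal_gen_mem (G : {pred R}) x : x \in G -> x \in ideal_gen G.
Proof.
move=> xG; apply/asboolP; exists [:: (1, x)]; split=> [c|].
  by rewrite inE => /eqP ->.
by rewrite big_seq1 mul1r.
Qed.

Lemma mem_ideal_mul I J a b : a \in I -> b \in J -> a * b \in ideal_mul I J.
Proof. by move=> aI bJ; apply/ideal_gen_mem/asboolP; exists a, b. Qed.

Lemma mem_ideal_expD I i j a b : a \in ideal_exp I i -> b \in ideal_exp I j ->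
  a * b \in ideal_exp I (i + j).
Proof.
elim: i a => [|i IHi] a; first by move=> _ /ideal_absorb.
move=> /asboolP[s [sG ->]] bj; rewrite mulr_suml big_seq.
apply: rpred_sum => c /sG /asboolP[u [v [uI vi ->]]].
rewrite addSn -!mulrA; apply: ideal_absorb.
by apply: mem_ideal_mul => //; apply: IHi.
Qed.

End IdealOperations.

Section QuotientModule.
Variables (R : comNzRingType) (I : ideal R).

(* R/I as an R-module; R/I as an additive group is the library's quotient.    *)
Definition quot_mod : Type := Quotient.quot I.
HB.instance Definition _ := GRing.Zmodule.on quot_mod.

Definition quot_scale (a : R) (x : quot_mod) : quot_mod :=
  \pi_(Quotient.quot I) (a * repr (x : Quotient.quot I)).

Lemma quot_scale_pi a u :
  quot_scale a (\pi_(Quotient.quot I) u) = \pi_(Quotient.quot I) (a * u).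
Proof.
apply/eqP; rewrite -Quotient.idealrBE -mulrBr; apply: ideal_absorb.
by rewrite Quotient.idealrBE reprK.
Qed.

Lemma quot_scaleA a b x : quot_scale a (quot_scale b x) = quot_scale (a * b) x.
Proof. by rewrite [quot_scale b x]/quot_scale quot_scale_pi mulrA. Qed.

Lemma quot_scale1 : left_id 1 quot_scale.
Proof. by move=> x; rewrite /quot_scale mul1r reprK. Qed.

Lemma quot_scaleDr : right_distributive quot_scale +%R.
Proof.
move=> a x y; rewrite -[x](@reprK _ (Quotient.quot I)).
rewrite -[y](@reprK _ (Quotient.quot I)).
by rewrite !quot_scale_pi -!raddfD quot_scale_pi mulrDr.
Qed.

Lemma quot_scaleDl x : {morph quot_scale^~ x : a b / a + b}.
Proof.
move=> a b; rewrite -[x](@reprK _ (Quotient.quot I)).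
by rewrite !quot_scale_pi -!raddfD mulrDl.
Qed.

HB.instance Definition _ := GRing.Zmodule_isLmodule.Build R quot_mod
  quot_scaleA quot_scale1 quot_scaleDr quot_scaleDl.

End QuotientModule.

(* The supremum of a set of naturals is 0 when the set is empty or unbounded; *)
(* neither happens for the depth of a nonzero finitely generated module over  *)
(* a Noetherian ring, nor for the Krull dimension of a nonzero algebra of     *)
(* finite type over a field.                                                  *)
Definition nat_sup (A : nat -> Prop) : nat := classical_sets.supremum 0%N A.

Section Depth.
Variables (R : comNzRingType) (M : lmodType R).

(* The submodule (f_1, ..., f_r) M. *)
Definition in_submod (fs : seq R) (x : M) : Prop :=
  exists y : 'I_(size fs) -> M, x = \sum_(i < size fs) fs`_i *: y i.

Definition regular_seq (fs : seq R) : Prop :=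
  (forall i, (i < size fs)%N -> forall x : M,
     in_submod (take i fs) (fs`_i *: x) -> in_submod (take i fs) x)
  /\ exists x : M, ~ in_submod fs x.

Definition depth (J : ideal R) : nat :=
  nat_sup (fun d => exists fs : seq R,
    [/\ {subset fs <= J}, regular_seq fs & size fs = d]).

End Depth.

(* Classically, boolean predicates capture all subsets of A; idealr_closed     *)
(* includes 1 \notin P.                                                       *)
Definition prime_ideal (A : comNzRingType) (P : {pred A}) : Prop :=
  idealr_closed P /\ prime_idealr_closed P.

Definition krull_dim (A : comNzRingType) : nat :=
  nat_sup (fun d => exists P : nat -> {pred A},
    (forall i, (i <= d)%N -> prime_ideal (P i)) /\
    (forall i, (i < d)%N -> {subset P i <= P i.+1}
                         /\ exists2 x, x \in P i.+1 & x \notin P i)).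

Section Rees.
Variables (R : comNzRingType) (I : ideal R).

(* R(I), as the subring of R[t] of the sums of a_k t^k with a_k in I^k.       *)
Definition in_rees : {pred {poly R}} :=
  [pred p : {poly R} | `[< forall k, p`_k \in ideal_exp I k >]].

Lemma in_rees_subring : subring_closed in_rees.
Proof.
split=> [|p q /asboolP pR /asboolP qR|p q /asboolP pR /asboolP qR];
  apply/asboolP => k.
- by rewrite coef1; case: k => [|k]; rewrite ?rpred0.
- by rewrite coefB rpredB.
- rewrite coefM rpred_sum // => i _.
  by have := mem_ideal_expD (pR i) (qR (k - i)%N); rewrite subnKC // leq_ord.
Qed.

HB.instance Definition _ :=
  GRing.isSubringClosed.Build {poly R} in_rees in_rees_subring.

Record rees := Rees { rees_val : {poly R}; _ : rees_val \in in_rees }.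

HB.instance Definition _ := [isSub for rees_val].
HB.instance Definition _ := [Choice of rees by <:].
HB.instance Definition _ := [SubChoice_isSubComNzRing of rees by <:].

End Rees.

Section AnalyticSpread.
Variables (K : fieldType) (n : nat).
Local Notation S := {mpoly K[n]}.

Definition monomial_prime (F : {set 'I_n}) : ideal S :=
  ideal_gen [pred x : S | [exists i in F, x == 'X_i]].

Definition max_ideal : ideal S := monomial_prime [set: 'I_n].

Variable I : ideal S.

(* The extension of max_ideal to R(I), max_ideal sitting in degree 0. *)
Definition fiber_ideal : {pred rees I} :=
  ideal_gen [pred p : rees I |
    `[< exists2 a, a \in max_ideal & rees_val p = a%:P >]].

HB.instance Definition _ := Ideal.on fiber_ideal.

Lemma max_ideal_at0 (x : S) : x \in max_ideal -> x.@[fun=> 0] = 0.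
Proof.
case/asboolP=> s [sX ->]; rewrite raddf_sum big_seq big1 // => c /sX.
case/exists_inP=> i _ /eqP->; by rewrite /= mevalM mevalXU mulr0.
Qed.

Lemma fiber_ideal_closed : idealr_closed fiber_ideal.
Proof.
split=> [||a u v uI vI]; [exact: rpred0| |exact/rpredD/vI/ideal_absorb].
apply/negP=> /asboolP[s [sm /(congr1 val)]].
rewrite rmorph1 raddf_sum => /(congr1 (fun p : {poly S} => (p`_0).@[fun=> 0])).
rewrite coef1 coef_sum rmorph1 raddf_sum big_seq big1 => [/eqP|c].
  by rewrite oner_eq0.
case/sm/asboolP=> a am cE.
have /= -> := rmorphM (val : rees I -> {poly S}) c.1 c.2.
by rewrite [rees_val c.2]cE coefMC mevalM (max_ideal_at0 am) mulr0.
Qed.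

HB.instance Definition _ :=
  isProperIdeal.Build (rees I) fiber_ideal
    (idealr_closed_nontrivial fiber_ideal_closed).

Definition fiber_ring : comNzRingType := {ideal_quot fiber_ideal}.

Definition analytic_spread : nat := krull_dim fiber_ring.

End AnalyticSpread.

Definition depth_quot (K : fieldType) (n : nat) (I : ideal {mpoly K[n]}) : nat :=
  depth (quot_mod I) (max_ideal K n).

Definition transversal_product (K : fieldType) (n : nat)
    (Fs : seq {set 'I_n}) : ideal {mpoly K[n]} :=
  \big[@ideal_mul _/(@full_ideal _ : ideal {mpoly K[n]})]_(F <- Fs)
    monomial_prime K F.

Definition transversal_polymatroidal (K : fieldType) (n : nat)
    (I : ideal {mpoly K[n]}) : Prop :=
  exists Fs : seq {set 'I_n},
    [/\ Fs != [::], {in Fs, forall F, F != set0}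
      & I =i transversal_product K Fs].

(* Main.v *)
(** The graph joining two variables whenever some [F_i] contains both has [C]
    components (free variables included); it is the same for [I] and [I^k], so
    everything follows from depth S/I = C - 1 and l(I) = n - C + 1.

    Depth: if [t] is a fixed component root, the differences [x_s - x_t], for [s]
    running over the other roots, form a regular sequence on [S/I]: modulo the
    previous ones [I] is a product of two ideals in disjoint sets of variables,
    hence their intersection, and one of them does not involve [x_t] while the
    other does not involve [x_s].  What is left is a product attached to a
    connected graph, which has a socle monomial of degree [r - 1].  Koszul
    cohomology turns this into a nonzero class in degree [C - 1], which bounds
    the length of every regular sequence.

    Analytic spread: the forms of degree [r k] in [I^k] identify the fiber ring
    with a ring spanned by monomials.  Identifying variables of a common [F_i]
    one after the other gives a chain of [n - C + 1] strict inclusions of primes.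
    Conversely a longer chain would give [n - C + 2] algebraically independent
    elements, but a monomial of the fiber ring is determined by [n - C + 1] of
    its exponents. *)

From HB Require Import structures.
Require Import Defs.
From mathcomp Require Import all_boot all_order all_algebra.
From mathcomp Require Import generic_quotient ring_quotient.
From mathcomp Require Import mpoly ring zify.
From mathcomp Require Import boolp.
From mathcomp Require classical_sets.

Set Implicit Arguments.
Unset Strict Implicit.
Unset Printing Implicit Defensive.

Import GRing.Theory.
Local Open Scope ring_scope.

(** * Regular sequences and Koszul cohomology *)

Lemma nat_sup_max (A : nat -> Prop) d :
  A d -> (forall e, A e -> (e <= d)%N) -> nat_sup A = d.
Proof.
move=> Ad Amax; rewrite /nat_sup /classical_sets.supremum.
case: ifPn => [/eqP A0|_]; first by move: Ad; rewrite A0.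
have dsup : classical_sets.supremums A d.
  by split=> [e /Amax //|e]; apply.
apply: classical_sets.xget_unique => // e esup.
exact: classical_sets.is_subset1_supremums esup dsup.
Qed.

Section RelativeRegularity.
Variable R : comNzRingType.
Implicit Types (N : R -> Prop) (f g : R) (fs gs : seq R).

Record idealP N : Prop := IdealP {
  idealP0 : N 0;
  idealPD : forall x y, N x -> N y -> N (x + y);
  idealPM : forall a x, N x -> N (a * x) }.

Lemma idealPN N x : idealP N -> N x -> N (- x).
Proof. by move=> iN Nx; rewrite -mulN1r; apply: idealPM. Qed.

Lemma idealPB N x y : idealP N -> N x -> N y -> N (x - y).
Proof. by move=> iN Nx Ny; apply: idealPD => //; apply: idealPN. Qed.

Lemma idealP_mem (I : ideal R) : idealP (fun x => x \in I).
Proof. split; [exact: rpred0|exact: rpredD|exact: ideal_absorb]. Qed.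

Definition ideal_adjoin N f : R -> Prop := fun x => exists a, N (x - a * f).

Lemma idealP_adjoin N f : idealP N -> idealP (ideal_adjoin N f).
Proof.
move=> iN; split=> [|x y [a Na] [b Nb]|c x [a Na]].
- by exists 0; rewrite mul0r subr0; apply: idealP0.
- by exists (a + b); rewrite mulrDl opprD addrACA; apply: idealPD.
- by exists (c * a); rewrite -mulrA -mulrBr; apply: idealPM.
Qed.

Lemma ideal_adjoin_sub N f x : N x -> ideal_adjoin N f x.
Proof. by exists 0; rewrite mul0r subr0. Qed.

(** Weak regularity: each element is regular modulo the previous ones. That the last quotient be
    nonzero is a separate conjunct in [regular_seq_quot]. *)
Fixpoint regular_mod N fs : Prop :=
  if fs is f :: fs' then
    (forall x, N (f * x) -> N x) /\ regular_mod (ideal_adjoin N f) fs'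
  else True.

Lemma foldl_adjoinP N fs x : 
  foldl ideal_adjoin N fs x <->
  exists y : 'I_(size fs) -> R, N (x - \sum_(i < size fs) y i * fs`_i).
Proof.
elim: fs N => [|f fs IH] N /=.
  split=> [Nx|[y]]; last by rewrite big_ord0 subr0.
  by exists (fun=> 0); rewrite big_ord0 subr0.
rewrite IH; split=> [[y [a Na]]|[y]].
  exists (fun i => oapp y a (unlift ord0 i)).
  rewrite big_ord_recl unlift_none /= opprD addrA addrAC.
  by under eq_bigr do rewrite liftK.
rewrite big_ord_recl => Ny; exists (fun i => y (lift ord0 i)), (y ord0).
by rewrite addrAC -addrA -opprD.
Qed.

Lemma regular_modP N fs : regular_mod N fs <->
  forall i, (i < size fs)%N -> forall x,
    foldl ideal_adjoin N (take i fs) (fs`_i * x) ->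
    foldl ideal_adjoin N (take i fs) x.
Proof.
elim: fs N => [|f fs IH] N //=; rewrite IH; split=> [[freg fsreg]|reg].
  by case=> [|i] //=; apply: fsreg.
by split=> [|i lti]; [apply: (reg 0%N)|apply: (reg i.+1)].
Qed.

End RelativeRegularity.

Section QuotientRegular.
Local Open Scope quotient_scope.
Variables (R : comNzRingType) (I : ideal R).

Lemma in_submod_quot (fs : seq R) u :
  in_submod fs (\pi_(Quotient.quot I) u : quot_mod I) <->
  foldl (@ideal_adjoin R) (fun x => x \in I) fs u.
Proof.
have piZ a v : a *: (\pi_(Quotient.quot I) v : quot_mod I) =
    \pi_(Quotient.quot I) (a * v) by exact: quot_scale_pi.
rewrite foldl_adjoinP; split=> [[y yE]|[y]].
  exists (fun i => repr (y i : Quotient.quot I)).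
  rewrite Quotient.idealrBE yE; apply/eqP; rewrite raddf_sum.
  apply: eq_bigr => i _; rewrite mulrC.
  have /= <- := piZ fs`_i (repr (y i : Quotient.quot I)).
  by rewrite reprK.
rewrite Quotient.idealrBE => /eqP uE.
exists (fun i => \pi_(Quotient.quot I) (y i)).
rewrite uE raddf_sum; apply: eq_bigr => i _.
by rewrite mulrC; apply/esym/piZ.
Qed.

Lemma regular_seq_quot (fs : seq R) :
  regular_seq (quot_mod I) fs <->
  regular_mod (fun x => x \in I) fs /\
  exists x, ~ foldl (@ideal_adjoin R) (fun x => x \in I) fs x.
Proof.
rewrite regular_modP; split=> [[reg [x xN]]|[reg [x xN]]].
  split=> [i lti u|].
    rewrite -!in_submod_quot => uin; apply: (reg i lti).
    by rewrite [_ *: _]quot_scale_pi.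
  exists (repr (x : Quotient.quot I)); rewrite -in_submod_quot.
  by rewrite reprK.
split=> [i lti u|]; last first.
  by exists (\pi_(Quotient.quot I) x); rewrite in_submod_quot.
rewrite -[u](@reprK _ (Quotient.quot I)).
rewrite [_ *: _]quot_scale_pi !in_submod_quot; exact: reg.
Qed.

End QuotientRegular.

Section Koszul.
Variable R : comNzRingType.
Implicit Types (N : R -> Prop) (xs cs fs : seq R) (w z : seq bool -> R).

(* A Koszul cochain is a function on the subsets of the list [xs], encoded as *)
(* bit strings; splitting off the first bit makes the Koszul complex of       *)
(* [x :: xs] the cone of multiplication by [x] on that of [xs].               *)
Fixpoint koszul xs w (b : seq bool) : R :=
  match xs, b with
  | x :: xs', c :: b' =>
      if c then x * w (false :: b') - koszul xs' (fun t => w (true :: t)) b'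
      else koszul xs' (fun t => w (false :: t)) b'
  | _, _ => 0
  end.

(** Contraction against [cs]. It lowers the degree by one and is a homotopy between multiplication
    by [dotp cs xs] and zero ([koszul_homotopyE]). *)
Fixpoint koszul_homotopy cs w (b : seq bool) : R :=
  match cs, b with
  | a :: cs', c :: b' =>
      if c then - koszul_homotopy cs' (fun t => w (true :: t)) b'
      else koszul_homotopy cs' (fun t => w (false :: t)) b' + a * w (true :: b')
  | _, _ => 0
  end.

Lemma koszul0 xs b : koszul xs (fun=> 0) b = 0.
Proof. by elim: xs b => [|x xs IH] [|[] b] //=; rewrite IH mulr0 subr0. Qed.

Lemma koszulD xs w z b :
  koszul xs (fun t => w t + z t) b = koszul xs w b + koszul xs z b.
Proof. by elim: xs w z b => [|x xs IH] w z [|[] b] /=; rewrite ?IH; ring. Qed.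

Lemma koszulZ xs a w b : koszul xs (fun t => a * w t) b = a * koszul xs w b.
Proof. by elim: xs w b => [|x xs IH] w [|[] b] /=; rewrite ?IH; ring. Qed.

Lemma koszulN xs w b : koszul xs (fun t => - w t) b = - koszul xs w b.
Proof. by elim: xs w b => [|x xs IH] w [|[] b] /=; rewrite ?IH; ring. Qed.

Lemma koszul_homotopyD cs w z b :
  koszul_homotopy cs (fun t => w t + z t) b =
  koszul_homotopy cs w b + koszul_homotopy cs z b.
Proof. by elim: cs w z b => [|x xs IH] w z [|[] b] /=; rewrite ?IH; ring. Qed.

Lemma koszul_homotopyZ cs a w b :
  koszul_homotopy cs (fun t => a * w t) b = a * koszul_homotopy cs w b.
Proof. by elim: cs w b => [|x xs IH] w [|[] b] /=; rewrite ?IH; ring. Qed.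

Lemma koszul_homotopyN cs w b :
  koszul_homotopy cs (fun t => - w t) b = - koszul_homotopy cs w b.
Proof. by elim: cs w b => [|x xs IH] w [|[] b] /=; rewrite ?IH; ring. Qed.

Lemma koszul_sub xs N w : idealP N -> 
  (forall b, size b = size xs -> N (w b)) ->
  forall b, size b = size xs -> N (koszul xs w b).
Proof.
move=> iN; elim: xs w => [|x xs IH] w Nw [|c b] //=.
  by move=> _; apply: idealP0.
move=> [sb]; case: c; last by apply: IH => // t st; apply: Nw; rewrite /= st.
apply: idealPB => //; first by apply: idealPM => //; apply: Nw; rewrite /= sb.
by apply: IH => // t st; apply: Nw; rewrite /= st.
Qed.

Lemma koszul_homotopy_sub cs N w : idealP N -> 
  (forall b, size b = size cs -> N (w b)) ->
  forall b, size b = size cs -> N (koszul_homotopy cs w b).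
Proof.
move=> iN; elim: cs w => [|x cs IH] w Nw [|c b] //=.
  by move=> _; apply: idealP0.
move=> [sb]; case: c.
  apply: idealPN => //; apply: IH => // t st; apply: Nw; by rewrite /= st.
apply: idealPD => //; last by apply: idealPM => //; apply: Nw; rewrite /= sb.
by apply: IH => // t st; apply: Nw; rewrite /= st.
Qed.

Lemma koszulK xs w b : koszul xs (koszul xs w) b = 0.
Proof.
elim: xs w b => [|x xs IH] w [|[] b] //=.
rewrite koszulD koszulZ koszulN !IH; ring.
Qed.

Definition dotp cs xs := \sum_(p <- zip cs xs) p.1 * p.2.

Lemma koszul_homotopyE xs cs w b : size cs = size xs -> size b = size xs ->
  koszul xs (koszul_homotopy cs w) b + koszul_homotopy cs (koszul xs w) b =
  dotp cs xs * w b.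
Proof.
rewrite /dotp; elim: xs cs w b => [|x xs IH] [|c cs] w [|i b] //=.
  by rewrite big_nil mul0r addr0.
move=> [sc] [sb]; rewrite big_cons mulrDl.
rewrite -(IH _ (fun t => w (i :: t))) //=.
case: i; rewrite ?(koszulD, koszulN, koszulZ).
  rewrite koszul_homotopyD koszul_homotopyZ koszul_homotopyN; ring.
ring.
Qed.

Lemma koszul_count xs w e :
  (forall b, count id b != e -> w b = 0) ->
  forall b, count id b != e.+1 -> koszul xs w b = 0.
Proof.
elim: xs w e => [|x xs IH] w e w0 [|[] b] //= be.
  rewrite w0 //= mulr0 sub0r.
  case: e w0 be => [|e] w0 be; last by rewrite (IH _ e) ?oppr0 // => t te; apply: w0.
  have -> : (fun t => w (true :: t)) = (fun t => 0 * w t).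
    by apply/funext => t; rewrite mul0r w0.
  by rewrite koszulZ mul0r oppr0.
by apply: (IH _ e) => // t te; apply: w0.
Qed.

Lemma koszul_count_eq xs w z e :
  (forall b, (count id b).+1 = e -> w b = z b) ->
  forall b, count id b = e -> koszul xs w b = koszul xs z b.
Proof.
elim: xs w z e => [|x xs IH] w z e wz [|[] b] //= be; last first.
  by apply: (IH _ _ e) => // t te; apply: wz; rewrite /= add0n.
case: e be wz => // e; rewrite add1n => -[be] wz; rewrite wz /= ?be //; congr (_ - _).
by apply: (IH _ _ e) => // t te; apply: wz; rewrite /= add1n te.
Qed.

Lemma koszul_homotopy_count xs w e :
  (forall b, count id b != e -> w b = 0) ->
  forall b, (count id b).+1 != e -> koszul_homotopy xs w b = 0.
Proof.
elim: xs w e => [|x xs IH] w e w0 [|[] b] //= be; last first.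
  by rewrite w0 //= (IH _ e) ?mulr0 ?addr0 // => t te; apply: w0.
by case: e w0 be => [|e] w0 be; [rewrite (IH _ 0%N)|rewrite (IH _ e)];
  rewrite ?oppr0 // => t te; apply: w0.
Qed.

(** A nonzero class in degree [e] of the Koszul cohomology of [xs] on R/N, represented by a cochain
    over R. Only strings of length [size xs] encode subsets of [xs]. *)
Definition koszul_class xs N e :=
  exists z, [/\ forall b, count id b != e -> z b = 0,
    forall b, size b = size xs -> N (koszul xs z b)
    & ~ exists w, forall b, size b = size xs -> N (z b - koszul xs w b)].

(** Write f for [dotp cs xs] and h for the homotopy. Then d(hz) = fz modulo N, so hz is a cocycle
    modulo (N, f). If hz = dw + uf modulo N, applying d gives fz = f du, and z = du since f is
    regular. *)
Lemma koszul_class_descend xs N cs e : idealP N -> size cs = size xs ->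
  (forall x, N (dotp cs xs * x) -> N x) ->
  koszul_class xs N e.+1 -> koszul_class xs (ideal_adjoin N (dotp cs xs)) e.
Proof.
move=> iN sc freg [z [ze zN znb]]; exists (koszul_homotopy cs z).
have hE b : size b = size xs ->
    N (koszul xs (koszul_homotopy cs z) b - dotp cs xs * z b).
  move=> sb; rewrite -koszul_homotopyE // opprD addrA subrr sub0r.
  by apply: idealPN => //; apply: koszul_homotopy_sub; rewrite ?sc.
split=> [b be|b sb|[w wN]].
- exact: koszul_homotopy_count ze _ be.
- by exists (z b); rewrite mulrC; apply: hE.
pose N' (b : seq bool) u := size b = size xs ->
  N (koszul_homotopy cs z b - koszul xs w b - u * dotp cs xs).
have /choice[u uN] : forall b, exists u, N' b u.
  move=> b; have [/eqP/wN[u uN]|/eqP sb] := boolP (size b == size xs).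
    by exists u.
  by exists 0.
apply: znb; exists u => b sb; apply: freg.
have := koszul_sub iN uN sb; rewrite koszulD koszulN.
have -> : koszul xs (fun t => koszul_homotopy cs z t - koszul xs w t) b =
    koszul xs (koszul_homotopy cs z) b.
  by rewrite koszulD koszulN koszulK oppr0 addr0.
have -> : koszul xs (fun t => u t * dotp cs xs) b = dotp cs xs * koszul xs u b.
  by rewrite -koszulZ; congr (koszul _ _ _); apply/funext => t; rewrite mulrC.
move=> /(idealPB iN)/(_ (hE b sb)); congr N; ring.
Qed.

(** Each regular element lowers the degree of the class by one. In degree zero hz = 0, so fz lies in
    N, and a regular f would force z into N. *)
Lemma koszul_class_bound xs N fs e : idealP N ->
  (forall f, f \in fs -> exists2 cs, size cs = size xs & f = dotp cs xs) ->
  regular_mod N fs -> koszul_class xs N e -> (size fs <= e)%N.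
Proof.
elim: fs N e => [|f fs IH] N e iN fsJ //= [freg fsreg].
have [|cs sc fE] := fsJ f; rewrite ?mem_head //.
case: e => [|e] ecl; last first.
  apply: (IH (ideal_adjoin N f)) => //; first exact: idealP_adjoin.
    by move=> g gfs; apply: fsJ; rewrite inE gfs orbT.
  by rewrite fE; apply: koszul_class_descend; rewrite // -fE.
case: ecl => z [ze zN znb]; exfalso; apply: znb; exists (fun=> 0) => b sb.
rewrite koszul0 subr0; apply: freg; rewrite fE -koszul_homotopyE //.
apply: idealPD => //; last by apply: koszul_homotopy_sub; rewrite ?sc.
rewrite (_ : koszul_homotopy cs z = (fun=> 0)) ?koszul0; first exact: idealP0.
by apply/funext => t; rewrite (koszul_homotopy_count _ ze).
Qed.

(** The connecting map: dz = gy modulo N, and y is a cocycle because g is regular. If y = dv, then z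
    - gv is a cocycle modulo N, hence a coboundary, so z is one modulo (N, g). *)
Lemma koszul_class_ascend xs N g e : idealP N ->
  (forall x, N (g * x) -> N x) -> ~ koszul_class xs N e ->
  koszul_class xs (ideal_adjoin N g) e -> koszul_class xs N e.+1.
Proof.
move=> iN greg ncl [z [ze zN znb]].
pose P (b : seq bool) y := (count id b != e.+1 -> y = 0) /\
  (size b = size xs -> N (koszul xs z b - g * y)).
have /choice[y yP] : forall b, exists y, P b y.
  move=> b; have [be|be] := boolP (count id b != e.+1).
    exists 0; split=> // _; rewrite (koszul_count _ ze be) mulr0 subr0; exact: idealP0.
  have [/eqP/zN[u uN]|/eqP sb] := boolP (size b == size xs).
    by exists u; split=> [|_]; rewrite ?(negPf be) 1?mulrC.
  by exists 0.
exists y; split=> [b /(proj1 (yP b))//|b sb|[v vN]].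
  apply: greg; rewrite -koszulZ -[X in N X]opprK -koszulN.
  apply: idealPN => //.
  rewrite -[X in N X]add0r -[X in X + _](koszulK xs z b) -koszulD.
  by apply: koszul_sub => // t /(proj2 (yP t)).
(* Only the part of [v] in degree [e] is kept, since a class must be represented in a single
   degree. *)
pose v' b := if count id b == e then v b else 0.
have v'N b : size b = size xs -> N (y b - koszul xs v' b).
  move=> sb; have [be|be] := eqVneq (count id b) e.+1.
    rewrite -(@koszul_count_eq xs v v' e.+1) //; first exact: vN.
    by move=> t [te]; rewrite /v' te eqxx.
  rewrite (proj1 (yP b) be) (@koszul_count xs v' e) ?subr0 //; first exact: idealP0.
  by move=> t te; rewrite /v' (negPf te).
apply: ncl; exists (fun b => z b - g * v' b); split=> [b be|b sb|[u uN]].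
- by rewrite ze // /v' (negPf be) mulr0 subr0.
- rewrite koszulD koszulN koszulZ.
  have := idealPD iN (proj2 (yP b) sb) (idealPM iN g (v'N b sb)).
  by congr N; ring.
apply: znb; exists u => b sb; exists (v' b).
by have := uN b sb; congr N; ring.
Qed.

(** The class climbs one degree for each element removed from the ideal; the vanishing that
    [koszul_class_ascend] requires comes from [koszul_class_bound]. *)
Lemma koszul_class_regular xs N gs e : idealP N -> size gs = e ->
  (forall g, g \in gs -> exists2 cs, size cs = size xs & g = dotp cs xs) ->
  regular_mod N gs ->
  koszul_class xs (foldl (@ideal_adjoin R) N gs) 0 -> koszul_class xs N e.
Proof.
move=> iN <- {e}; elim: gs N iN => [|g gs IH] N iN gsJ //= [greg gsreg] cl.
apply: koszul_class_ascend (greg) _ _ => //.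
  by move=> /(koszul_class_bound iN gsJ (conj greg gsreg)); rewrite /= ltnn.
apply: IH => //; first exact: idealP_adjoin.
by move=> f fgs; apply: gsJ; rewrite inE fgs orbT.
Qed.

(** In degree zero a cocycle is an element killed by all of [xs], and there are no coboundaries. *)
Lemma koszul_class_socle xs N (w : R) : idealP N -> ~ N w ->
  (forall x, x \in xs -> N (x * w)) -> koszul_class xs N 0.
Proof.
move=> iN nNw xsN; pose z (b : seq bool) := if count id b == 0%N then w else 0.
exists z; split=> [b /negPf bn0|b sb|[v vN]]; first by rewrite /z bn0.
  elim: xs xsN b {sb} => [|x xs IH] xsN [|[] b] //=; try exact: idealP0.
    rewrite -/(z (false :: b)) koszul0 subr0 /z /=.
    case: ifP => _; last by rewrite mulr0; apply: idealP0.
    by apply: xsN; rewrite mem_head.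
  by apply: IH => y ys; apply: xsN; rewrite inE ys orbT.
apply: nNw; have := vN (nseq (size xs) false) (size_nseq _ _).
have -> : koszul xs v (nseq (size xs) false) = 0.
  by elim: xs v {vN xsN} => [|x xs IH] v //=.
by rewrite subr0 /z count_nseq.
Qed.

Lemma idealP_foldl N fs : idealP N -> idealP (foldl (@ideal_adjoin R) N fs).
Proof.
by elim: fs N => [|f fs IH] N iN //=; apply/IH/idealP_adjoin.
Qed.

(* A socle element modulo the regular sequence [gs] lifts to a nonzero Koszul *)
(* class of degree [size gs] of [R/I], which bounds every regular sequence.   *)
Lemma depth_regular_socle (I J : ideal R) xs gs (w : R) :
  (forall f, f \in J -> exists2 cs, size cs = size xs & f = dotp cs xs) ->
  {subset gs <= J} -> regular_mod (fun x => x \in I) gs ->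
  let N := foldl (@ideal_adjoin R) (fun x => x \in I) gs in
  ~ N w -> (forall x, x \in xs -> N (x * w)) ->
  depth (quot_mod I) J = size gs.
Proof.
move=> Jxs gsJ gsreg N nNw xsNw; apply: nat_sup_max.
  by exists gs; split=> //; apply/regular_seq_quot; split=> //; exists w.
have iI := idealP_mem I.
have cl : koszul_class xs (fun x => x \in I) (size gs).
  apply: (koszul_class_regular iI erefl _ gsreg) => [g /gsJ /Jxs //|].
  exact: koszul_class_socle (idealP_foldl gs iI) nNw xsNw.
move=> _ [fs [fsJ /regular_seq_quot[fsreg _] <-]].
by apply: (koszul_class_bound iI _ fsreg cl) => f /fsJ /Jxs.
Qed.

End Koszul.

(** * Products of monomial primes *)

Section TransversalMonomials.
Variable n : nat.
Implicit Types (F V : {set 'I_n}) (Fs Gs : seq {set 'I_n}) (m : 'X_{1..n}).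

(* [tmon Fs m]: the monomial [X^m] is a multiple of some [x_{j_1}...x_{j_r}]  *)
(* with [j_i] in the [i]-th set of [Fs].                                      *)
Fixpoint tmon Fs m : bool :=
  if Fs is F :: Fs' then [exists j in F, (0 < m j)%N && tmon Fs' (m - U_(j))]
  else true.

Lemma tmon_consP F Fs m :
  reflect (exists j, [/\ j \in F, (0 < m j)%N & tmon Fs (m - U_(j))])
          (tmon (F :: Fs) m).
Proof.
apply: (iffP exists_inP) => [[j jF /andP[mj tm]]|[j [jF mj tm]]]; exists j => //.
by rewrite mj.
Qed.

Lemma mnm1K m j : (0 < m j)%N -> (U_(j) + (m - U_(j)) = m)%MM.
Proof. by move=> mj; rewrite addmC submK // lep1mP -lt0n. Qed.

Lemma tmon_sub Fs m m' :
  (forall F j, F \in Fs -> j \in F -> (m j <= m' j)%N) ->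
  tmon Fs m -> tmon Fs m'.
Proof.
elim: Fs m m' => //= F Fs IH m m' mm' /tmon_consP[j [jF mj tm]].
apply/tmon_consP; exists j; split=> //.
  by apply: leq_trans mj _; apply: mm' jF; rewrite mem_head.
apply: IH tm => G i GFs iG; rewrite !mnmBE leq_sub2r //; apply: mm' iG.
by rewrite inE GFs orbT.
Qed.

Lemma tmonW Fs m m' : (m <= m')%MM -> tmon Fs m -> tmon Fs m'.
Proof. by move=> /mnm_lepP mm'; apply: tmon_sub. Qed.

Lemma tmonD Fs Gs m m' : tmon Fs m -> tmon Gs m' -> tmon (Fs ++ Gs) (m + m').
Proof.
elim: Fs m => [|F Fs IH] m /= => [_|/tmon_consP[j [jF mj tm]] tm'].
  by apply: tmonW; apply: lem_addl.
apply/tmon_consP; exists j; split=> //; first by rewrite mnmDE ltn_addr.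
rewrite addmC -addmBA ?lep1mP -?lt0n // addmC; exact: IH.
Qed.

(** The exact degree of [m1] matters: with [Gs] empty, this extracts from [m] a generator of the
    product. *)
Lemma tmon_catP Fs Gs m : tmon (Fs ++ Gs) m ->
  exists m1 m2, [/\ m = (m1 + m2)%MM, tmon Fs m1, tmon Gs m2
                  & mdeg m1 = size Fs].
Proof.
elim: Fs m => [|F Fs IH] m /= => [tm|/tmon_consP[j [jF mj /IH]]].
  by exists 0%MM, m; rewrite add0m mdeg0.
move=> [m1 [m2 [mE tm1 tm2 dm1]]]; exists (U_(j) + m1)%MM, m2; split=> //.
- by rewrite -addmA -mE mnm1K.
- apply/tmon_consP; exists j; split=> //; first by rewrite mnmDE mnm1E eqxx.
  by rewrite addmC addmK.
- by rewrite mdegD mdeg1 dm1 add1n.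
Qed.

Lemma tmon_perm Fs Gs : perm_eq Fs Gs -> tmon Fs =1 tmon Gs.
Proof.
suff sub : forall m Fs Gs, perm_eq Fs Gs -> tmon Fs m -> tmon Gs m.
  by move=> FG m; apply/idP/idP; apply: sub; rewrite // perm_sym.
move=> {Fs Gs} m; apply: (catCA_perm_ind (P := fun Fs => tmon Fs m)).
move=> G1 G2 G3 /tmon_catP[m1 [_ [-> tm1 /tmon_catP[m2 [m3 [-> tm2 tm3 _]]] _]]].
rewrite addmA [(m1 + m2)%MM]addmC -addmA.
by apply: tmonD => //; apply: tmonD.
Qed.

Lemma tmon_mdeg Fs m : tmon Fs m -> (size Fs <= mdeg m)%N.
Proof.
rewrite -[X in tmon X]cats0 => /tmon_catP[m1 [m2 [-> _ _ <-]]].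
by rewrite mdegD leq_addr.
Qed.

(** Each set inside [V] uses up one variable of [V]. Applied to a component and to its complement,
    this determines the multidegrees in the fiber ring. *)
Lemma tmon_count Fs V m : tmon Fs m ->
  (count (fun F => F \subset V) Fs <= \sum_(i in V) m i)%N.
Proof.
elim: Fs m => //= F Fs IH m /tmon_consP[j [jF mj /IH]].
have [/subsetP/(_ _ jF) jV|_] := boolP (F \subset V); last first.
  move=> /leq_trans-> //; apply: leq_sum => i _; by rewrite mnmBE leq_subr.
rewrite (bigD1 j) //= [in X in _ -> X](bigD1 j) //= mnmBE mnm1E eqxx.
under eq_bigr => i /andP[_ ij] do rewrite mnmBE mnm1E eq_sym (negPf ij) subn0.
lia.
Qed.

(** The two selections draw on disjoint sets of variables, so neither disturbs the other: a product
    of ideals in disjoint variables is their intersection. *)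
Lemma tmon_split Fs V m :
  (forall F, F \in Fs -> F \subset V \/ F \subset ~: V) ->
  tmon [seq F : {set 'I_n} <- Fs | F \subset V] m ->
  tmon [seq F : {set 'I_n} <- Fs | ~~ (F \subset V)] m -> tmon Fs m.
Proof.
elim: Fs m => //= F Fs IH m FsV.
have FsV' G : G \in Fs -> G \subset V \/ G \subset ~: V.
  by move=> GFs; apply: FsV; rewrite inE GFs orbT.
have {}IH m' := IH m' FsV'.
case: ifP => [FV|FnV] /=.
  move=> /exists_inP[j jF /andP[mj tm1]] tm2; apply/tmon_consP.
  exists j; split=> //; apply: IH => //; apply: tmon_sub tm2 => G i.
  rewrite mem_filter => /andP[GV /FsV'[|/subsetP GV' /GV']]; first by rewrite (negPf GV).
  rewrite inE mnmBE mnm1E; case: eqP => [<-|_]; last by rewrite subn0.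
  by rewrite (subsetP FV).
move=> tm1 /exists_inP[j jF /andP[mj tm2]]; apply/tmon_consP.
exists j; split=> //; apply: IH => //; apply: tmon_sub tm1 => G i.
rewrite mem_filter => /andP[/subsetP GV _ /GV iV].
rewrite mnmBE mnm1E; case: eqP => [jE|_]; last by rewrite subn0.
have [|/subsetP/(_ _ jF)] := FsV F (mem_head _ _); first by rewrite FnV.
by rewrite inE jE iV.
Qed.

End TransversalMonomials.

Section MonomialIdeals.
Variables (K : fieldType) (n : nat).
Local Notation S := {mpoly K[n]}.
Implicit Types (F : {set 'I_n}) (Fs Gs : seq {set 'I_n}) (m : 'X_{1..n}).
Implicit Types (Q : pred 'X_{1..n}) (p q : S) (I J : ideal S).

Definition monid Q : {pred S} := [pred p | all Q (msupp p)].

Definition upclosed Q := forall m m', Q m -> Q (m + m')%MM.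

Lemma monidP Q p : reflect (forall m, p@_m != 0 -> Q m) (p \in monid Q).
Proof.
apply: (iffP allP) => [pQ m|pQ m].
  by rewrite -mcoeff_msupp; apply: pQ.
by rewrite mcoeff_msupp; apply: pQ.
Qed.

Lemma tmon_upclosed Fs : upclosed (tmon Fs).
Proof. by move=> m m'; apply: tmonW; apply: lem_addr. Qed.

Lemma msuppM_split p q m : (p * q)@_m != 0 ->
  exists m1 m2, [/\ m = (m1 + m2)%MM, p@_m1 != 0 & q@_m2 != 0].
Proof.
rewrite -mcoeff_msupp => /msuppM_le/allpairsP[[m1 m2] /= [m1p m2q ->]].
by exists m1, m2; rewrite -!mcoeff_msupp.
Qed.

Lemma monid_idealP Q : upclosed Q -> idealP (fun p => p \in monid Q).
Proof.
move=> upQ; split=> [|p q /monidP pQ /monidP qQ|a p /monidP pQ].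
- by apply/monidP => m; rewrite mcoeff0 eqxx.
- apply/monidP => m; rewrite mcoeffD => pqm.
  have [pm|] := eqVneq p@_m 0; last exact: pQ.
  by apply: qQ; move: pqm; rewrite pm add0r.
- apply/monidP => m /msuppM_split[m1 [m2 [-> _ /pQ]]].
  by rewrite addmC; apply: upQ.
Qed.

Lemma monidX Q m : 'X_[K, m] \in monid Q = Q m.
Proof. by rewrite !inE msuppX /= andbT. Qed.

Lemma monid_ideal Q I p : (forall m, Q m -> 'X_[K, m] \in I) ->
  p \in monid Q -> p \in I.
Proof.
move=> QI /monidP pQ; rewrite [p]mpolyE big_seq rpred_sum // => m.
rewrite mcoeff_msupp => /pQ /QI XI; rewrite -mul_mpolyC; exact: ideal_absorb.
Qed.

Lemma idealP_sum N (T : eqType) (r : seq T) (f : T -> S) : idealP N ->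
  (forall t, t \in r -> N (f t)) -> N (\sum_(t <- r) f t).
Proof.
move=> iN rN; rewrite big_seq; elim/big_ind: _ => //.
  exact: idealP0.
exact: idealPD.
Qed.

Lemma ideal_mul_monid I J Fs Gs : I =i monid (tmon Fs) -> J =i monid (tmon Gs) ->
  ideal_mul I J =i monid (tmon (Fs ++ Gs)).
Proof.
move=> IE JE p; have iFG := monid_idealP (@tmon_upclosed (Fs ++ Gs)).
apply/idP/idP => [/asboolP[s [sG ->]]|].
  apply: (idealP_sum iFG) => c /sG /asboolP[a [b [aI bJ ->]]].
  apply: (idealPM iFG); apply/monidP => m /msuppM_split[m1 [m2 [-> am bm]]].
  apply: tmonD; first by move: am; apply/monidP; rewrite -IE.
  by move: bm; apply/monidP; rewrite -JE.
apply: monid_ideal => m /tmon_catP[m1 [m2 [-> tm1 tm2 _]]].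
by rewrite mpolyXD; apply: mem_ideal_mul; rewrite ?IE ?JE monidX.
Qed.

Lemma full_ideal_monid : (@full_ideal S : ideal S) =i monid (tmon [::]).
Proof. by move=> p; rewrite !inE; apply/esym/allP. Qed.

Lemma monomial_prime_monid F : monomial_prime K F =i monid (tmon [:: F]).
Proof.
move=> p; have iF := monid_idealP (@tmon_upclosed [:: F]).
apply/idP/idP => [/asboolP[s [sG ->]]|].
  apply: (idealP_sum iF) => c /sG /exists_inP[i iFi /eqP->].
  apply: (idealPM iF); rewrite monidX; apply/tmon_consP.
  by exists i; rewrite mnm1E eqxx.
apply: monid_ideal => m /tmon_consP[j [jF mj _]].
rewrite -(mnm1K mj) mpolyXD mulrC; apply: ideal_absorb.
by apply: ideal_gen_mem; apply/exists_inP; exists j.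
Qed.

Lemma transversal_product_monid Fs :
  transversal_product K Fs =i monid (tmon Fs).
Proof.
rewrite /transversal_product; elim: Fs => [|F Fs IH].
  by rewrite big_nil; apply: full_ideal_monid.
rewrite big_cons -cat1s; exact: ideal_mul_monid (@monomial_prime_monid F) IH.
Qed.

Lemma ideal_exp_monid I Fs k : I =i monid (tmon Fs) ->
  ideal_exp I k =i monid (tmon (flatten (nseq k Fs))).
Proof.
move=> IE; elim: k => [|k IH] /=; first exact: full_ideal_monid.
exact: ideal_mul_monid.
Qed.

End MonomialIdeals.

(** * Connected components of the graph of the sets *)

Section Components.
Variable n : nat.
Implicit Types (F V : {set 'I_n}) (Fs Gs L : seq {set 'I_n}) (m : 'X_{1..n}).

Definition adjacent Fs : rel 'I_n :=
  fun a b => has (fun F => (a \in F) && (b \in F)) Fs.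

Definition component Fs : 'I_n -> 'I_n := fingraph.root (adjacent Fs).

(* Variables dividing no generator form components of their own. *)
Definition component_roots Fs : {set 'I_n} := [set a | component Fs a == a].

Lemma adjacent_sym Fs : connect_sym (adjacent Fs).
Proof.
apply: sym_connect_sym => a b; apply: eq_has => F; exact: andbC.
Qed.

Lemma component_id Fs a : component Fs (component Fs a) = component Fs a.
Proof. exact/root_root/adjacent_sym. Qed.

Lemma component_eq Fs F a b : F \in Fs -> a \in F -> b \in F ->
  component Fs a = component Fs b.
Proof.
move=> FFs aF bF; apply/eqP; rewrite (root_connect (@adjacent_sym Fs)).
by apply: connect1; apply/hasP; exists F; rewrite ?aF.
Qed.

(** A function constant on each set is constant along paths of adjacent variables. *)
Lemma component_universal (T : Type) Fs (g : 'I_n -> T) :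
  (forall F, F \in Fs -> {in F &, forall a b, g a = g b}) ->
  forall a, g (component Fs a) = g a.
Proof.
move=> gF a; have /connectP[p] := connect_root (adjacent Fs) a.
rewrite -/(component Fs a) => + ->; elim: p a => //= b p IH a /andP[+ /IH->].
by case/hasP=> F /gF gFF /andP[aF bF]; apply: gFF.
Qed.

Definition covered Fs a := has (fun F => a \in F) Fs.

Lemma covered_component Fs a : covered Fs (component Fs a) = covered Fs a.
Proof.
apply: component_universal => F FFs b c bF cF.
by rewrite /covered; apply/hasP/hasP => _; exists F.
Qed.

(** If no set contains [a], the predicate [pred1 a] is false on all sets, hence constant on
    components, and the root of [a] is [a]. *)
Lemma covered_nonroot Fs a : component Fs a != a -> covered Fs a.
Proof.
apply: contraR => /hasPn aFs; rewrite -[_ == _]/(pred1 a _).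
rewrite component_universal ?eqxx //= => F /aFs aF b c bF cF /=.
by rewrite (negPf (memPn aF _ bF)) (negPf (memPn aF _ cF)).
Qed.

Lemma eq_component Fs Gs : Fs =i Gs -> component Fs =1 component Gs.
Proof.
move=> FG; apply: eq_root => a b; exact: eq_has_r.
Qed.

(* The sets are added one at a time, each meeting the union of the previous   *)
(* ones in some [s]; the socle monomial is the product of these [x_s].        *)
Lemma connected_socle Fs : Fs != [::] -> {in Fs, forall F, F != set0} ->
  (forall F G a b, F \in Fs -> G \in Fs -> a \in F -> b \in G ->
    component Fs a = component Fs b) ->
  exists m, [/\ (mdeg m).+1 = size Fs,
    forall j, (0 < m j)%N -> covered Fs j
    & forall j, covered Fs j -> tmon Fs (m + U_(j))].
Proof.
move=> Fs0 Fne conn.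
pose P Gs := exists m, [/\ (mdeg m).+1 = size Gs,
    forall j, (0 < m j)%N -> covered Gs j
    & forall j, covered Gs j -> tmon Gs (m + U_(j))].
have Pperm Gs Gs' : perm_eq Gs Gs' -> P Gs -> P Gs'.
  move=> GG' [m [dm sm tm]]; have cov j : covered Gs j = covered Gs' j.
    by apply: eq_has_r; apply: perm_mem.
  exists m; rewrite -(perm_size GG'); split=> // j; rewrite -cov //.
    exact: sm.
  rewrite -(tmon_perm GG'); exact: tm.
suff Pk k : (k < size Fs)%N ->
    exists Gs Hs, [/\ perm_eq (Gs ++ Hs) Fs, size Gs = k.+1 & P Gs].
  have [|Gs [Hs [GHF sG PG]]] := Pk (size Fs).-1.
    by rewrite ltn_predL lt0n size_eq0.
  apply: Pperm PG; suff H0 : Hs = [::] by rewrite H0 cats0 in GHF.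
  apply/eqP; rewrite -size_eq0; have := perm_size GHF.
  rewrite size_cat sG prednK; last by rewrite lt0n size_eq0.
  by move=> /eqP; rewrite -[X in _ == X]addn0 eqn_add2l.
elim: k => [_|k IH ltk].
  case: Fs Fs0 {Fne conn} => // F Fs _; exists [:: F], Fs; split=> //.
  exists 0%MM; split=> [|j|j]; first by rewrite mdeg0.
    by rewrite mnm0E.
  by case/hasP=> _ /[1!inE]/eqP-> jF; rewrite add0m; apply/tmon_consP;
  exists j; rewrite mnm1E eqxx.
have [|Gs [Hs [GHF sG [m [dm sm tm]]]]] := IH; first exact: ltnW.
have memF G : G \in Fs = (G \in Gs) || (G \in Hs).
  by rewrite -(perm_mem GHF) mem_cat.
(* If no remaining set met the variables already covered, [covered Gs] would be constant on
   components and separate [Gs] from [Hs], against connectedness. *)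
have [F FHs [s sF scov]] : exists2 F, F \in Hs & exists2 s, s \in F & covered Gs s.
  apply: contrapT => no.
  have Gs_disj F s : F \in Hs -> s \in F -> covered Gs s = false.
    by move=> FHs sF; apply/negP => cs; apply: no; exists F => //; exists s.
  have uni : forall F, F \in Fs -> {in F &, forall a b, covered Gs a = covered Gs b}.
    move=> F; rewrite memF => /orP[FGs|FHs] a b aF bF; last by rewrite !(Gs_disj F).
    by apply/hasP/hasP => _; exists F.
  case: Gs sG GHF memF {dm sm tm no} Gs_disj uni => // G Gs sG GHF memF Gs_disj uni.
  case: Hs GHF memF Gs_disj => [|H Hs] GHF memF Gs_disj.
    by have := perm_size GHF; rewrite cats0 sG => szF; move: ltk; rewrite -szF ltnn.
  have GFs : G \in Fs by rewrite memF mem_head.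
  have HFs : H \in Fs by rewrite memF mem_head orbT.
  have /set0Pn[a aG] := Fne _ GFs; have /set0Pn[b bH] := Fne _ HFs.
  have := component_universal uni a.
  rewrite (conn G H a b) // (component_universal uni) (Gs_disj H) ?mem_head //.
  by rewrite /covered /= aG.
exists (F :: Gs), (rem F Hs); split=> //=; last exists (m + U_(s))%MM.
- apply: perm_trans GHF; rewrite perm_sym -cat1s catA.
  rewrite (perm_catl _ (perm_to_rem FHs)) perm_sym -[F :: rem F Hs]cat1s catA.
  by rewrite perm_cat2r perm_catC.
- by rewrite sG.
- split=> [|j|j].
  + by rewrite mdegD mdeg1 addn1 dm.
  + rewrite mnmDE mnm1E /covered /=; case: eqP => [<- _|_]; first by rewrite sF.
    by rewrite addn0 => /sm /hasP[G GGs jG]; apply/orP; right; apply/hasP; exists G.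
  + have tmF i : i \in F -> tmon [:: F] (U_(i)).
      by move=> iF; apply/tmon_consP; exists i; rewrite mnm1E eqxx.
    (* If [j] is in [F], then [F] takes [x_j] and [Gs] divides the rest, [m + U_(s)]; otherwise [F]
       takes [x_s] and [m + U_(j)] is left for [Gs]. *)
    rewrite {1}/covered [has _ _]/= => /orP[jF|jcov]; rewrite -cat1s.
      by rewrite addmC; apply: tmonD; rewrite ?tmF ?tm.
    by rewrite [(m + _)%MM]addmC -addmA; apply: tmonD; rewrite ?tmF ?tm.
Qed.

End Components.

(** * Depth *)

Section VariableSubstitution.
Variables (K : fieldType) (n : nat).
Local Notation S := {mpoly K[n]}.
Implicit Types (m : 'X_{1..n}) (p q : S) (phi psi : 'I_n -> 'I_n).

Fact msub_key : unit. Proof. exact: tt. Qed.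
Definition msub phi : S -> S :=
  locked_with msub_key (mmap (@mpolyC n K) (fun i => 'X_(phi i))).

Lemma msubE phi : msub phi = mmap (@mpolyC n K) (fun i => 'X_(phi i)).
Proof. by rewrite /msub unlock. Qed.

Lemma msub_is_zmod_morphism phi : zmod_morphism (msub phi).
Proof. by move=> p q; rewrite msubE rmorphB. Qed.

Lemma msub_is_monoid_morphism phi : monoid_morphism (msub phi).
Proof. by split=> [|p q]; rewrite msubE ?rmorph1 ?rmorphM. Qed.

HB.instance Definition _ phi :=
  GRing.isZmodMorphism.Build S S (msub phi) (msub_is_zmod_morphism phi).
HB.instance Definition _ phi :=
  GRing.isMonoidMorphism.Build S S (msub phi) (msub_is_monoid_morphism phi).

Definition mnm_sub phi m : 'X_{1..n} := (\sum_(i < n) U_(phi i) *+ m i)%MM.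

Lemma msubC phi c : msub phi c%:MP = c%:MP.
Proof. by rewrite msubE mmapC. Qed.

Lemma msubX phi m : msub phi 'X_[m] = 'X_[mnm_sub phi m].
Proof.
rewrite msubE mmapX /mmap1 /mnm_sub -mprodXE.
by apply: eq_bigr => i _; rewrite mpolyXn.
Qed.

Lemma msubXU phi i : msub phi 'X_i = 'X_(phi i).
Proof. by rewrite msubE mmapX mmap1U. Qed.

Lemma mnm_subD phi m m' : mnm_sub phi (m + m') = (mnm_sub phi m + mnm_sub phi m')%MM.
Proof.
apply/mnmP => j; rewrite mnmDE !mnm_sumE -big_split; apply: eq_bigr => i _ /=.
by rewrite !mulmnE mnmDE mulnDr.
Qed.

Lemma mnm_subU phi i : mnm_sub phi U_(i) = U_(phi i)%MM.
Proof.
apply/mnmP => j; rewrite mnm_sumE (bigD1 i) //= mulmnE (mnm1E i i) eqxx muln1.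
rewrite big1 ?addn0 // => k /negPf ki; by rewrite mulmnE (mnm1E i k) eq_sym ki muln0.
Qed.

Lemma mpoly_ind_gen (P : S -> Prop) :
  (forall c, P c%:MP) -> (forall i, P 'X_i) ->
  (forall p q, P p -> P q -> P (p + q)) ->
  (forall p q, P p -> P q -> P (p * q)) -> forall p, P p.
Proof.
move=> PC PX PD PM p; rewrite [p]mpolyE.
apply: (big_ind P) => [||m _]; [by rewrite -mpolyC0|exact: PD|].
rewrite -mul_mpolyC; apply: (PM) => //; rewrite mpolyXE_id.
apply: (big_ind P) => [||i _]; [by rewrite -mpolyC1|exact: PM|].
by elim: (m i) => [|k IH]; rewrite ?expr0 -?mpolyC1 ?exprS //; apply: PM.
Qed.

Lemma msub_comp phi psi p : msub psi (msub phi p) = msub (psi \o phi) p.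
Proof.
elim/mpoly_ind_gen: p => [c|i|p q IHp IHq|p q IHp IHq].
- by rewrite !msubC.
- by rewrite !msubXU.
- by rewrite !rmorphD /= IHp IHq.
- by rewrite !rmorphM /= IHp IHq.
Qed.

Lemma msub_congr N phi p : idealP N -> (forall i, N ('X_i - 'X_(phi i))) ->
  N (p - msub phi p).
Proof.
move=> iN NX; elim/mpoly_ind_gen: p => [c|i|p q IHp IHq|p q IHp IHq].
- by rewrite msubC subrr; apply: idealP0.
- by rewrite msubXU.
- by rewrite rmorphD opprD addrACA; apply: idealPD.
- rewrite rmorphM (_ : _ - _ = q * (p - msub phi p) + msub phi p * (q - msub phi q)).
    by apply: idealPD => //; apply: idealPM.
  ring.
Qed.

End VariableSubstitution.

Section RegularDifference.
Variables (K : fieldType) (n : nat).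
Local Notation S := {mpoly K[n]}.
Implicit Types (m : 'X_{1..n}) (p q : S) (Q : pred 'X_{1..n}).

(* Among the monomials of [q] outside [Q], one of maximal degree in [x_t]     *)
(* cannot cancel in the product.                                              *)
Lemma monid_regular Q s t q : upclosed Q -> s != t ->
  (forall m, Q (m + U_(t))%MM -> Q m) ->
  ('X_s - 'X_t) * q \in monid Q -> q \in monid Q.
Proof.
move=> upQ st Qt /monidP stq; apply/monidP => m0 qm0; apply: contraT => nQ0.
(* Instead of choosing a maximum, the exponent of [t] is raised step by step until it exceeds every
   degree in the support of [q]. *)
suff climb k : exists m, [/\ ~~ Q m, q@_m != 0 & (k <= m t)%N].
  have [m [_ qm km]] := climb (msize q).
  move: qm; rewrite -mcoeff_msupp => /msize_mdeg_lt; rewrite ltnNge.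
  by rewrite (leq_trans km) // mdegE (bigD1 t) //= leq_addr.
elim: k => [|k [m [nQ qm km]]]; first by exists m0.
have nQt : ~~ Q (m + U_(t))%MM by apply: contra nQ; apply: Qt.
(* Since this coefficient vanishes, [q] has a nonzero coefficient at [m + U_(t) - U_(s)], whose
   exponent at [t] is one larger. *)
have : (('X_s - 'X_t) * q)@_(m + U_(t)) == 0 by apply: contraR nQt; apply: stq.
rewrite mulrBl mcoeffB subr_eq0 !(mulrC 'X_(_)) => /eqP.
rewrite [in RHS]addmC mcoeffMX => qE.
have /msuppM_split[m1 [m2 [mE qm1]]] : (q * 'X_s)@_(m + U_(t)) != 0 by rewrite qE.
rewrite mcoeffX; case: (eqVneq U_(s)%MM m2) => [m2E _|]; last by rewrite eqxx.
exists m1; split=> //.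
  by apply: contra nQt => Qm1; rewrite mE; apply: upQ.
have := congr1 (fun m => m t) mE; rewrite !mnmDE -m2E !mnm1E eqxx (negPf st) addn0 addn1.
by move=> <-; rewrite ltnS.
Qed.

End RegularDifference.

Section TransversalDepth.
Variables (K : fieldType) (n : nat).
Local Notation S := {mpoly K[n]}.
Implicit Types (m : 'X_{1..n}) (p q : S) (Fs : seq {set 'I_n}) (L : seq 'I_n).

Definition collapse L (t : 'I_n) : 'I_n -> 'I_n :=
  fun j => if j \in L then t else j.

Definition image_sets (phi : 'I_n -> 'I_n) Fs : seq {set 'I_n} :=
  [seq phi @: (F : {set 'I_n}) | F <- Fs].

Lemma tmon_image phi Fs m : tmon Fs m -> tmon (image_sets phi Fs) (mnm_sub phi m).
Proof.
elim: Fs m => // F Fs IH m /tmon_consP[j [jF mj /IH tm]].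
rewrite -(mnm1K mj) mnm_subD mnm_subU [image_sets _ _]/= -cat1s; apply: tmonD tm.
by apply/tmon_consP; exists (phi j); rewrite mnm1E eqxx imset_f.
Qed.

Lemma tmon_image_lift phi Fs m : tmon (image_sets phi Fs) m ->
  exists m0 m1, m = (mnm_sub phi m0 + m1)%MM /\ tmon Fs m0.
Proof.
elim: Fs m => [|F Fs IH] m.
  exists 0%MM, m; split=> //; apply/mnmP => j; rewrite mnmDE mnm_sumE big1 ?add0n //.
  by move=> i _; rewrite mulmnE mnm0E muln0.
move=> /tmon_consP[_ [/imsetP[j jF ->] mj /IH[m0 [m1 [mE tm]]]]].
exists (U_(j) + m0)%MM, m1; split.
  by rewrite mnm_subD mnm_subU -addmA -mE mnm1K.
by rewrite -cat1s; apply: tmonD => //; apply/tmon_consP; exists j; rewrite mnm1E eqxx.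
Qed.

Lemma foldl_adjoin_min (R : comNzRingType) (N N' : R -> Prop) fs x : idealP N' ->
  (forall y, N y -> N' y) -> (forall f, f \in fs -> N' f) ->
  foldl (@ideal_adjoin R) N fs x -> N' x.
Proof.
move=> iN'; elim: fs N => [|f fs IH] N NN' fsN' /=; first exact: NN'.
apply: IH => [y [a /NN' Na]|g gfs]; last by apply: fsN'; rewrite inE gfs orbT.
rewrite -[y](subrK (a * f)); apply: idealPD => //.
by apply: idealPM => //; apply: fsN'; rewrite mem_head.
Qed.

Lemma foldl_adjoin_sub (R : comNzRingType) (N : R -> Prop) fs x :
  N x -> foldl (@ideal_adjoin R) N fs x.
Proof. by elim: fs N => //= f fs IH N Nx; apply/IH/ideal_adjoin_sub. Qed.

Lemma foldl_adjoin_mem (R : comNzRingType) (N : R -> Prop) fs f : idealP N ->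
  f \in fs -> foldl (@ideal_adjoin R) N fs f.
Proof.
elim: fs N => //= g fs IH N iN /[1!inE] /orP[/eqP ->|ffs].
  by apply: foldl_adjoin_sub; exists 1; rewrite mul1r subrr; apply: idealP0.
by apply: IH ffs; apply: idealP_adjoin.
Qed.

(** The substitution kills the differences and sends [I] into the product of the image sets.
    Conversely [p] and its image are congruent modulo the differences, and monomials of the image
    product lift to [I] up to a factor. *)
Lemma adjoin_differences Fs (I : ideal S) L t p : I =i monid (tmon Fs) ->
  foldl (@ideal_adjoin S) (fun x => x \in I) [seq 'X_s - 'X_t | s <- L] p <->
  msub (collapse L t) p \in monid (tmon (image_sets (collapse L t) Fs)).
Proof.
move=> IE; set phi := collapse L t; set fs := map _ L.
have phit : phi t = t by rewrite /phi /collapse if_same.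
have iI := idealP_mem I; have iM := monid_idealP K (@tmon_upclosed _ (image_sets phi Fs)).
split.
  apply: (@foldl_adjoin_min _ _ (fun p => msub phi p \in _)).
  - split=> [|x y xN yN|a x xN]; first by rewrite rmorph0; apply: (idealP0 iM).
      by rewrite rmorphD; apply: (idealPD iM).
    by rewrite rmorphM; apply: (idealPM iM).
  - move=> x; rewrite IE => /monidP xI; rewrite [x]mpolyE rmorph_sum.
    apply: (idealP_sum iM) => m; rewrite mcoeff_msupp => /xI tm.
    rewrite -mul_mpolyC rmorphM /= msubX; apply: (idealPM iM).
    by rewrite monidX; apply: tmon_image.
  - move=> _ /mapP[s sL ->]; rewrite rmorphB /= !msubXU phit /phi /collapse sL.
    by rewrite subrr; apply: (idealP0 iM).
have iN := idealP_foldl fs iI; move=> pM; set N := foldl _ _ _ in iN *.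
have NX i : N ('X_i - 'X_(phi i)).
  rewrite /phi /collapse; case: ifP => [iL|_]; last by rewrite subrr; apply: idealP0.
  by apply: foldl_adjoin_mem => //; apply/mapP; exists i.
rewrite -[p](subrK (msub phi p)); apply: (idealPD iN); first exact: msub_congr.
move: pM => /monidP pM; rewrite [msub phi p]mpolyE.
apply: (idealP_sum iN) => m; rewrite mcoeff_msupp => /pM /tmon_image_lift.
move=> [m0 [m1 [-> tm]]]; rewrite -mul_mpolyC; apply: (idealPM iN).
rewrite mpolyXD mulrC; apply: (idealPM iN).
rewrite -msubX -(subKr 'X_[m0] (msub phi _)); apply: (idealPB iN).
  by apply: foldl_adjoin_sub; rewrite IE monidX.
exact: msub_congr.
Qed.

(** The component [V] of [s] splits the collapsed product: the factor of the sets inside [V] does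
    not involve [x_t], the other does not involve [x_s]. Each is handled by [monid_regular]. *)
Lemma difference_regular Fs (I : ideal S) L s t p : I =i monid (tmon Fs) ->
  {subset L <= component_roots Fs} -> s \in component_roots Fs -> s \notin L ->
  t \in component_roots Fs -> s != t ->
  let N := foldl (@ideal_adjoin S) (fun x => x \in I) [seq 'X_s - 'X_t | s <- L] in
  N (('X_s - 'X_t) * p) -> N p.
Proof.
move=> IE Lroot sroot sL troot st N /(adjoin_differences _ _ _ IE) spM.
apply/(adjoin_differences _ _ _ IE); move: spM.
set phi := collapse L t; set Gs := image_sets phi Fs.
have phit : phi t = t by rewrite /phi /collapse if_same.
have phis : phi s = s by rewrite /phi /collapse (negPf sL).
rewrite rmorphM rmorphB /= !msubXU phit phis; move: (msub phi p) => q sqM.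
pose V := [set a | component Fs a == s].
have sV : s \in V by move: sroot; rewrite !inE.
have tV : t \notin V by move: troot; rewrite !inE => /eqP->; rewrite eq_sym.
(* The elements of [L] are roots other than [s], so they lie outside [V], as does [t]. *)
have phiV a : (phi a \in V) = (a \in V).
  rewrite /phi /collapse; case: ifP => // aL; rewrite (negPf tV).
  have := Lroot _ aL; rewrite !inE => /eqP->; apply/esym/eqP => as_.
  by rewrite -as_ aL in sL.
have GsV G : G \in Gs -> G \subset V \/ G \subset ~: V.
  case/mapP=> F FFs ->; have [->|/set0Pn[a aF]] := eqVneq F set0.
    by left; rewrite imset0 sub0set.
  have FV b : b \in F -> (phi b \in V) = (a \in V).
    by move=> bF; rewrite phiV !inE (component_eq FFs aF bF).
  have [aV|aV] := boolP (a \in V); [left|right];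
    by apply/subsetP => _ /imsetP[b bF ->]; rewrite ?in_setC FV.
have QE m : tmon [seq G : {set 'I_n} <- Gs | G \subset V] m ->
    tmon [seq G : {set 'I_n} <- Gs | ~~ (G \subset V)] m -> tmon Gs m.
  exact: tmon_split.
have tmon_filter (P : pred {set 'I_n}) m : tmon Gs m -> tmon (filter P Gs) m.
  move: (Gs) => Hs; elim: Hs m => //= H Hs IH m /tmon_consP[j [jH mj tm]].
  case: (P H); first by apply/tmon_consP; exists j; split=> //; apply: IH.
  by apply: IH; apply: tmonW tm; apply: lem_subr.
have monid_filter (P : pred {set 'I_n}) r :
    r \in @monid K n (tmon Gs) -> r \in monid (tmon (filter P Gs)).
  by move=> /monidP rM; apply/monidP => m /rM; apply: tmon_filter.
apply/monidP => m qm; apply: QE; move: m qm; apply/monidP.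
  apply: (monid_regular (@tmon_upclosed _ _) st _ (monid_filter _ _ sqM)) => m.
  apply: tmon_sub => G j; rewrite mem_filter => /andP[/subsetP GV _ /GV jV].
  rewrite mnmDE mnm1E; case: eqP => [jt|_]; last by rewrite addn0.
  by rewrite jt jV in tV.
(* A change of sign exchanges the roles of [s] and [t]. *)
have := monid_filter (fun G => ~~ (G \subset V)) _ sqM.
rewrite -[X in X \in _]opprK -mulNr opprB => /(idealPN (monid_idealP K (@tmon_upclosed _ _))).
rewrite opprK; apply: monid_regular (@tmon_upclosed _ _) _ _; first by rewrite eq_sym.
move=> m; apply: tmon_sub => G j; rewrite mem_filter => /andP[GnV /GsV[GV|/subsetP GV]].
  by rewrite GV in GnV.
move=> /GV; rewrite in_setC mnmDE mnm1E; case: eqP => [<-|_]; last by rewrite addn0.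
by rewrite sV.
Qed.

End TransversalDepth.

Section DepthFormula.
Variables (K : fieldType) (n : nat).
Local Notation S := {mpoly K[n]}.
Implicit Types (m : 'X_{1..n}) (p q : S) (Fs : seq {set 'I_n}) (L : seq 'I_n).

Definition variables : seq S := [seq 'X_i | i <- enum 'I_n].

Lemma max_ideal_dotp f : f \in max_ideal K n ->
  exists2 cs, size cs = size variables & f = dotp cs variables.
Proof.
move=> fJ; suff [c ->] : exists c : 'I_n -> S, f = \sum_i c i * 'X_i.
  exists [seq c i | i <- enum 'I_n]; first by rewrite !size_map.
  rewrite /dotp /variables zip_map big_map /=.
  by rewrite big_enum.
case/asboolP: fJ => r [rX ->]; elim: r rX => [|d r IH] rX.
  by exists (fun=> 0); rewrite big_nil big1 // => i _; rewrite mul0r.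
have [|c cE] := IH; first by move=> e er; apply: rX; rewrite inE er orbT.
have /exists_inP[j _ /eqP djE] := rX d (mem_head _ _).
exists (fun i => (if i == j then d.1 else 0) + c i).
rewrite big_cons cE djE.
under [RHS]eq_bigr do rewrite mulrDl.
rewrite big_split /= [in RHS](bigD1 j) //= eqxx.
by rewrite [in RHS]big1 ?addr0 // => i /negPf->; rewrite mul0r.
Qed.

Lemma max_idealX (i : 'I_n) : 'X_i \in max_ideal K n.
Proof. by apply: ideal_gen_mem; apply/exists_inP; exists i; rewrite ?inE. Qed.

Lemma msub_supp_id phi m : (forall j, (0 < m j)%N -> phi j = j) ->
  mnm_sub phi m = m.
Proof.
move=> phim; rewrite [RHS]multinomUE_id; apply: eq_bigr => i _.
by case: (posnP (m i)) => [->|/phim ->]; rewrite ?mulm0n.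
Qed.

Theorem depth_transversal Fs (I : ideal S) : I =i monid (tmon Fs) ->
  Fs != [::] -> {in Fs, forall F, F != set0} ->
  depth_quot I = #|component_roots Fs|.-1.
Proof.
move=> IE Fs0 Fne.
have [F0 F0Fs] : exists F, F \in Fs.
  by case: (Fs) Fs0 => // F ? _; exists F; rewrite mem_head.
have /set0Pn[a0 a0F] := Fne _ F0Fs.
pose t := component Fs a0.
have troot : t \in component_roots Fs by rewrite inE /t component_id eqxx.
(* With [t] covered, every variable is covered after the collapse, free ones included; the socle
   condition is needed for all of them. *)
have tcov : covered Fs t by rewrite covered_component; apply/hasP; exists F0.
pose L := enum (component_roots Fs :\ t); pose phi := collapse L t.
have memL s : (s \in L) = (s != t) && (s \in component_roots Fs).
  by rewrite mem_enum in_setD1.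
have phit : phi t = t by rewrite /phi /collapse if_same.
have phi_root s : s \in component_roots Fs -> phi s = t.
  by rewrite /phi /collapse memL => ->; case: eqVneq.
have phi_cov j : covered (image_sets phi Fs) (phi j).
  have [jr|/covered_nonroot] := eqVneq (component Fs j) j.
    rewrite phi_root ?inE ?jr //; case/hasP: tcov => F FFs tF.
    by apply/hasP; exists (phi @: F); rewrite ?map_f // -phit imset_f.
  by case/hasP=> F FFs jF; apply/hasP; exists (phi @: F); rewrite ?map_f // imset_f.
have phi_id j : covered (image_sets phi Fs) j -> phi j = j.
  case/hasP=> _ /mapP[F _ ->] /imsetP[i _ ->]; rewrite /phi /collapse.
  by case: (boolP (i \in L)) => [_|/negPf ->]; rewrite ?if_same.
have [] := @connected_socle _ (image_sets phi Fs).
- by rewrite -size_eq0 size_map size_eq0.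
- by move=> _ /mapP[F /Fne/set0Pn[a aF] ->]; apply/set0Pn; exists (phi a); apply: imset_f.
(* Connectedness after the collapse: [g] takes the same value at a variable and at its root, and all
   roots collapse to [t]. *)
- pose g := component (image_sets phi Fs) \o phi.
  have gt a : g a = component (image_sets phi Fs) t.
    rewrite -(@component_universal _ _ Fs g) /g => [|F FFs b c bF cF] /=.
      by rewrite phi_root // inE component_id.
    by apply: (@component_eq _ _ (phi @: F)); rewrite ?map_f ?imset_f.
  move=> _ _ _ _ /mapP[F _ ->] /mapP[G _ ->] /imsetP[a _ ->] /imsetP[b _ ->].
  by rewrite [LHS](gt a) [RHS](gt b).
move=> m [mdegm msupp_cov socm].
have mphi : mnm_sub phi m = m by apply: msub_supp_id => j /msupp_cov /phi_id.
pose gs : seq S := [seq 'X_s - 'X_t | s <- L].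
have -> : #|component_roots Fs|.-1 = size gs.
  by rewrite size_map -cardE (cardsD1 t (component_roots Fs)) troot.
apply: (@depth_regular_socle _ _ _ variables gs 'X_[m]).
- exact: max_ideal_dotp.
- move=> _ /mapP[s _ ->]; exact: rpredB (max_idealX s) (max_idealX t).
- apply/regular_modP => i; rewrite size_map => ltiL p.
  rewrite -map_take (nth_map t) //.
  apply: (difference_regular IE) => //.
  + by move=> s /mem_take; rewrite memL => /andP[].
  + by have := mem_nth t ltiL; rewrite memL => /andP[].
  + have /uniqP-/(_ t) uL := enum_uniq (component_roots Fs :\ t).
    apply/negP => /(nthP t)[j]; rewrite size_takel ?(ltnW ltiL) // => ltji.
    rewrite nth_take // => /uL; rewrite !inE => /(_ (ltn_trans ltji ltiL) ltiL) ji.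
    by rewrite ji ltnn in ltji.
  + by have := mem_nth t ltiL; rewrite memL => /andP[].
(* The degree of [m] is one less than the number of sets, too small for the ideal. *)
- move=> /(adjoin_differences _ _ _ IE); rewrite -/phi msubX mphi monidX.
  by move=> /tmon_mdeg; rewrite -mdegm ltnn.
- move=> _ /mapP[j _ ->]; apply/(adjoin_differences _ _ _ IE).
  rewrite -/phi rmorphM /= msubXU msubX mphi -mpolyXD monidX addmC.
  exact: socm.
Qed.

End DepthFormula.

(** * Initial forms on the Rees algebra *)

Section HomogeneousComponents.
Variables (K : fieldType) (n : nat).
Local Notation S := {mpoly K[n]}.
Implicit Types (m : 'X_{1..n}) (p q : S).

(* [p(s x_1, ..., s x_n)] as a polynomial in [s]. *)
Definition mscale : S -> {poly S} :=
  mmap ((@polyC S) \o (@mpolyC n K)) (fun i => ('X_i)%:P * 'X).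

(** This coefficient is the homogeneous component of degree [d]; the multiplicativity of [mscale]
    then gives the convolution formula [hcompM]. *)
Fact hcomp_exists : {hc : nat -> S -> S | forall d p, hc d p = (mscale p)`_d}.
Proof. by exists (fun d p => (mscale p)`_d). Qed.

Definition hcomp := sval hcomp_exists.

Lemma hcomp_mscale d p : hcomp d p = (mscale p)`_d.
Proof. exact: (svalP hcomp_exists). Qed.

Lemma mscaleX m : mscale 'X_[m] = ('X_[m])%:P * 'X^(mdeg m).
Proof.
rewrite /mscale mmapX /mmap1.
under eq_bigr do rewrite exprMn -rmorphXn /=.
by rewrite big_split /= -rmorph_prod /= -mpolyXE_id prodrXr -mdegE.
Qed.

Lemma hcompZX d c m :
  hcomp d (c *: 'X_[m]) = if mdeg m == d then c *: 'X_[m] else 0.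
Proof.
rewrite hcomp_mscale -mul_mpolyC /mscale rmorphM /= mmapC -/mscale mscaleX /=.
rewrite !coefCM coefXn eq_sym; case: eqP => _; first by rewrite mulr1.
by rewrite !mulr0.
Qed.

Lemma hcomp_sum d (T : Type) (r : seq T) (f : T -> S) :
  hcomp d (\sum_(x <- r) f x) = \sum_(x <- r) hcomp d (f x).
Proof.
rewrite hcomp_mscale /mscale rmorph_sum coef_sum.
by apply: eq_bigr => x _; rewrite hcomp_mscale.
Qed.

Lemma hcompE d p m : (hcomp d p)@_m = if mdeg m == d then p@_m else 0.
Proof.
rewrite {1}[p]mpolyE hcomp_sum raddf_sum /=; case: eqP => [<-|/eqP dm].
  rewrite [in RHS](mpolyE p) [RHS]raddf_sum; apply: eq_bigr => m' _ /=.
  rewrite hcompZX; case: eqP => // dm'; rewrite mcoeff0 mcoeffZ mcoeffX.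
  by case: eqP dm' => [->//|_ _]; rewrite mulr0.
rewrite big1_seq // => m' _; rewrite hcompZX; case: eqP => [dm'|_]; last by rewrite mcoeff0.
rewrite mcoeffZ mcoeffX; case: eqP => [mm|_]; last by rewrite mulr0.
by rewrite -dm' mm eqxx in dm.
Qed.

Lemma hcompB d : {morph hcomp d : p q / p - q}.
Proof. by move=> p q; rewrite !hcomp_mscale /mscale rmorphB coefB. Qed.

Lemma hcompM d p q : hcomp d (p * q) = \sum_(i < d.+1) hcomp i p * hcomp (d - i) q.
Proof.
rewrite hcomp_mscale /mscale rmorphM coefM.
by apply: eq_bigr => i _; rewrite !hcomp_mscale.
Qed.

End HomogeneousComponents.

Section ReesCoercion.
Variables (R : comNzRingType) (I : ideal R).
Implicit Types u v : rees I.

Lemma rees_valB u v : rees_val (u - v) = rees_val u - rees_val v.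
Proof. exact: (rmorphB (val : rees I -> {poly R}) u v). Qed.

Lemma rees_valD u v : rees_val (u + v) = rees_val u + rees_val v.
Proof. exact: (rmorphD (val : rees I -> {poly R}) u v). Qed.

Lemma rees_valM u v : rees_val (u * v) = rees_val u * rees_val v.
Proof. exact: (rmorphM (val : rees I -> {poly R}) u v). Qed.

Lemma rees_val1 : rees_val (1 : rees I) = 1.
Proof. exact: (rmorph1 (val : rees I -> {poly R})). Qed.

Lemma rees_val0 : rees_val (0 : rees I) = 0.
Proof. exact: (rmorph0 (val : rees I -> {poly R})). Qed.

(* Opaque, lest unification compute in the subring [rees I]. *)
Fact rees_coef_exists : {c : rees I -> nat -> R | forall u k, c u k = (rees_val u)`_k}.
Proof. by exists (fun u k => (rees_val u)`_k). Qed.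

Definition rees_coef := sval rees_coef_exists.

Lemma rees_coefE u k : rees_coef u k = (rees_val u)`_k.
Proof. exact: (svalP rees_coef_exists). Qed.

Lemma rees_coef_ideal u k : rees_coef u k \in ideal_exp I k.
Proof. by rewrite rees_coefE; have /asboolP := valP u. Qed.

Lemma rees_coefB k : {morph rees_coef^~ k : u v / u - v}.
Proof. by move=> u v; rewrite !rees_coefE rees_valB coefB. Qed.

Lemma rees_coefM u v k :
  rees_coef (u * v) k = \sum_(i < k.+1) rees_coef u i * rees_coef v (k - i).
Proof.
by rewrite rees_coefE rees_valM coefM; under [RHS]eq_bigr do rewrite !rees_coefE.
Qed.

Lemma rees_coef1 k : rees_coef 1 k = (k == 0%N)%:R.
Proof. by rewrite rees_coefE rees_val1 coef1. Qed.

Lemma rees_coef_eq0 u k : (size (rees_val u) <= k)%N -> rees_coef u k = 0.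
Proof. by rewrite rees_coefE; apply: nth_default. Qed.

End ReesCoercion.

Section InitialForms.
Local Open Scope quotient_scope.
Variables (K : fieldType) (n : nat).
Local Notation S := {mpoly K[n]}.
Implicit Types (m : 'X_{1..n}) (p q : S).
Variables (Fs : seq {set 'I_n}) (I : ideal S).
Hypothesis IE : I =i monid (tmon Fs).
Local Notation r := (size Fs).
Local Notation Fsk k := (flatten (nseq k Fs)).

Lemma ideal_exp_tmon k p m : p \in ideal_exp I k -> p@_m != 0 ->
  tmon (Fsk k) m.
Proof. by rewrite (ideal_exp_monid k IE) => /monidP; apply. Qed.

Lemma size_flatten_nseq k : size (Fsk k) = (r * k)%N.
Proof. by rewrite size_flatten /shape map_nseq sumn_nseq. Qed.

Lemma hcomp_ideal_exp k d p : p \in ideal_exp I k -> (d < r * k)%N ->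
  hcomp d p = 0.
Proof.
move=> pI ltd; apply/mpolyP => m; rewrite hcompE mcoeff0.
case: eqP => [dm|//]; apply/eqP; apply: contraTT ltd => /(ideal_exp_tmon pI)/tmon_mdeg.
by rewrite size_flatten_nseq dm -leqNgt.
Qed.

(* [I^k] is generated in degree [r k]; keeping only that degree identifies    *)
(* the fiber ring with a subring of [S[t]].                                   *)

Lemma hcomp0 d : hcomp d (0 : S) = 0.
Proof. by rewrite !hcomp_mscale /mscale rmorph0 coef0. Qed.

Fact initial_form_exists : {h : rees I -> {poly S} |
  forall u k, (h u)`_k = hcomp (r * k) (rees_coef u k)}.
Proof.
exists (fun u => \poly_(k < size (rees_val u)) hcomp (r * k) (rees_coef u k)).
by move=> u k; rewrite coef_poly; case: ltnP => // /rees_coef_eq0 ->; rewrite hcomp0.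
Qed.

Definition initial_form := sval initial_form_exists.

Lemma coef_initial_form u k :
  (initial_form u)`_k = hcomp (r * k) (rees_coef u k).
Proof. exact: (svalP initial_form_exists). Qed.

Lemma initial_formB : {morph initial_form : u v / u - v}.
Proof.
move=> u v; apply/polyP => k.
rewrite [LHS]coef_initial_form [RHS]coefB rees_coefB hcompB.
by rewrite !coef_initial_form.
Qed.

(** In degree r k, only the product of the parts of degrees r i and r (k - i) survives: any other
    term has a factor below the least degree of its power of [I]. *)
Lemma initial_formM : {morph initial_form : u v / u * v}.
Proof.
move=> u v; apply/polyP => k; rewrite [RHS]coefM [LHS]coef_initial_form.
rewrite rees_coefM hcomp_sum; apply: eq_bigr => i _; rewrite !coef_initial_form hcompM.
have ik : (r * i <= r * k)%N by rewrite leq_mul2l -ltnS ltn_ord orbT.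
rewrite (bigD1 (Ordinal (_ : (r * i < (r * k).+1)%N))) //= -mulnBr big1 ?addr0 //.
move=> d; rewrite -val_eqE /= neq_ltn => /orP[ltd|gtd].
  by rewrite (hcomp_ideal_exp (rees_coef_ideal u i) ltd) mul0r.
rewrite mulrC (hcomp_ideal_exp (rees_coef_ideal v _)) ?mul0r //.
rewrite mulnBr; have := ltn_ord d; lia.
Qed.

Lemma initial_form1 : initial_form 1 = 1.
Proof.
apply/polyP => k; rewrite coef_initial_form rees_coef1 coef1.
case: k => [|k] /=; last exact: hcomp0.
by rewrite muln0 !hcomp_mscale /mscale rmorph1 coef1.
Qed.

Lemma initial_form0 : initial_form 0 = 0.
Proof. by rewrite -[0 in LHS](subrr 1) initial_formB subrr. Qed.

Lemma initial_formD : {morph initial_form : u v / u + v}.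
Proof.
move=> u v; have := initial_formB (u + v) v.
by rewrite addrK => /eqP; rewrite eq_sym subr_eq => /eqP.
Qed.

(** The initial form of a generator is the constant term of an element of the maximal ideal, which
    is zero. *)
Lemma initial_form_fiber u : u \in @fiber_ideal K n I -> initial_form u = 0.
Proof.
case/asboolP=> s [sG ->]; elim: s sG => [|c s IH] sG.
  by rewrite big_nil initial_form0.
rewrite big_cons initial_formD IH ?addr0; last first.
  by move=> d ds; apply: sG; rewrite inE ds orbT.
rewrite initial_formM; have /asboolP[a aI cE] := sG c (mem_head _ _).
rewrite [X in _ * X](_ : _ = 0) ?mulr0 //; apply/polyP => k.
rewrite coef_initial_form coef0 rees_coefE cE coefC.
case: k => [|k] /=; last exact: hcomp0.
apply/mpolyP => m; rewrite hcompE mcoeff0 muln0 mdeg_eq0.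
case: eqP => // ->; apply/eqP; move: aI; rewrite monomial_prime_monid.
by move=> /monidP a0; apply: contraT => /a0 /tmon_mdeg; rewrite mdeg0.
Qed.

End InitialForms.

Section FiberPrimes.
Local Open Scope quotient_scope.
Variables (K : fieldType) (n : nat).
Local Notation S := {mpoly K[n]}.
Variable I : ideal S.
Local Notation J := (@fiber_ideal K n I).

(** A map to a domain has a prime kernel, and it descends to the fiber ring because it kills [J]. *)
Lemma prime_kernel (T : idomainType) (H : rees I -> T) :
  {morph H : u v / u - v} -> {morph H : u v / u * v} -> H 1 = 1 ->
  (forall u, u \in J -> H u = 0) ->
  exists P : {pred fiber_ring I}, prime_ideal P /\
    forall u, (\pi_({ideal_quot J}) u \in P) = (H u == 0).
Proof.
move=> HB HM H1 HJ.
pose P : {pred fiber_ring I} := [pred y | H (repr (y : {ideal_quot J})) == 0].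
have PE u : (\pi_({ideal_quot J}) u \in P) = (H u == 0).
  rewrite inE /= -subr_eq0 subr0.
  have : repr (\pi_({ideal_quot J}) u) - u \in J by rewrite Quotient.idealrBE reprK.
  by move/HJ; rewrite HB => /eqP; rewrite subr_eq0 => /eqP->.
have H0 : H 0 = 0 by rewrite -[0 in LHS](subrr 1) HB subrr.
have HD u v : H (u + v) = H u + H v.
  by have /eqP := HB (u + v) v; rewrite addrK eq_sym subr_eq => /eqP.
exists P; split=> //; split; first split.
- by rewrite -(rmorph0 (\pi_({ideal_quot J}))) PE H0.
- by rewrite -(rmorph1 (\pi_({ideal_quot J}))) PE H1 oner_eq0.
- move=> a u v; rewrite -(@reprK _ {ideal_quot J} a) -(@reprK _ {ideal_quot J} u).
  rewrite -(@reprK _ {ideal_quot J} v).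
  rewrite -(rmorphM (\pi_({ideal_quot J}))) -(rmorphD (\pi_({ideal_quot J}))) !PE.
  by move=> /eqP Hu /eqP Hv; rewrite HD HM Hu Hv mulr0 addr0.
- move=> u v; rewrite -(@reprK _ {ideal_quot J} u) -(@reprK _ {ideal_quot J} v).
  by rewrite -(rmorphM (\pi_({ideal_quot J}))) !PE HM mulf_eq0.
Qed.

End FiberPrimes.

(** * Krull dimension of the fiber ring *)

Section MergingChain.
Variables (n : nat) (Fs : seq {set 'I_n}).
Implicit Types phi psi : 'I_n -> 'I_n.

Definition merging phi psi := exists F a b,
  [/\ F \in Fs, a \in F, b \in F, phi a != phi b
    & psi = (fun j => if j == phi a then phi b else j) \o phi].

(** If nothing can be merged, [phi] is constant on components, so its image is no larger than the
    set of roots. *)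
Lemma merging_exists phi :
  (#|component_roots Fs| < #|phi @: setT|)%N -> exists psi, merging phi psi.
Proof.
move=> ltphi; apply: contrapT => no.
have /component_universal phiE :
    forall F, F \in Fs -> {in F &, forall a b, phi a = phi b}.
  move=> F FFs a b aF bF; apply/eqP; apply: contrapT => /negP ab; apply: no.
  by eexists; exists F, a, b; split.
move: ltphi; rewrite ltnNge => /negP; apply.
apply: leq_trans (leq_imset_card phi (component_roots Fs)).
apply/subset_leq_card/subsetP => _ /imsetP[a _ ->]; rewrite -phiE.
by apply: imset_f; rewrite inE component_id.
Qed.

Lemma merging_card phi psi : merging phi psi ->
  (#|phi @: setT| <= #|psi @: setT|.+1)%N.
Proof.
move=> [F [a [b [_ _ _ _ ->]]]]; set psi' := _ \o _.
rewrite -add1n -(cards1 (phi a)); apply: leq_trans (leq_card_setU _ _).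
apply/subset_leq_card/subsetP => _ /imsetP[j _ ->]; rewrite in_setU in_set1.
case: eqVneq => //= ja; apply/imsetP; exists j => //.
by rewrite /psi' /= (negPf ja).
Qed.

(** Starting from n distinct variables, each merging loses at most one, so a further one is possible
    until only as many remain as there are components. *)
Lemma merging_chain : exists phi : nat -> 'I_n -> 'I_n,
  forall i, (i < n - #|component_roots Fs|)%N -> merging (phi i) (phi i.+1).
Proof.
have /choice[step stepP] phi : exists psi,
    (#|component_roots Fs| < #|phi @: setT|)%N -> merging phi psi.
  have [/merging_exists[psi ?]|] := boolP (#|component_roots Fs| < #|phi @: setT|)%N.
    by exists psi.
  by exists id.
have card_iter i : (i <= n - #|component_roots Fs|)%N ->
    (n - i <= #|iter i step id @: setT|)%N.
  elim: i => [_|i IH lti]; first by rewrite imset_id cardsT card_ord subn0.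
  have := IH (ltnW lti) => lei.
  have /merging_card : merging (iter i step id) (iter i.+1 step id).
    by apply: stepP; apply: leq_trans lei; rewrite ltn_subRL addnC -ltn_subRL.
  by rewrite subnS -ltnS; case: (n - i)%N lei => [|k] //= ; apply: leq_trans.
exists (fun i => iter i step id) => i lti; apply: stepP.
by apply: leq_trans (card_iter i (ltnW lti)); rewrite ltn_subRL addnC -ltn_subRL.
Qed.

End MergingChain.

Section KrullLower.
Local Open Scope quotient_scope.
Variables (K : fieldType) (n : nat).
Local Notation S := {mpoly K[n]}.
Implicit Types (m : 'X_{1..n}) (p q : S).
Variables (Fs : seq {set 'I_n}) (I : ideal S).
Hypothesis IE : I =i monid (tmon Fs).
Hypothesis Fne : {in Fs, forall F, F != set0}.

Lemma tmon_exists (Gs : seq {set 'I_n}) : {in Gs, forall F, F != set0} ->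
  exists2 m, tmon Gs m & mdeg m = size Gs.
Proof.
elim: Gs => [|G Gs IH] Gne; first by exists 0%MM; rewrite ?mdeg0.
have [|m tm dm] := IH; first by move=> F FGs; apply: Gne; rewrite inE FGs orbT.
have /set0Pn[j jG] := Gne G (mem_head _ _).
exists (U_(j) + m)%MM; last by rewrite mdegD mdeg1 dm.
by rewrite -cat1s; apply: tmonD => //; apply/tmon_consP; exists j; rewrite mnm1E eqxx.
Qed.

Lemma rees_monomial_val k c : c \in ideal_exp I k ->
  exists u : rees I, rees_val u = c *: 'X^k.
Proof.
move=> cI; have uI : c *: 'X^k \in in_rees I.
  apply/asboolP => j; rewrite coefZ coefXn; case: eqP => [->|_].
    by rewrite mulr1.
  by rewrite mulr0 rpred0.
by exists (Rees uI).
Qed.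

Lemma rees_monomial k c : c \in ideal_exp I k ->
  exists u : rees I, forall j, rees_coef u j = if j == k then c else 0.
Proof.
move=> /rees_monomial_val[u uE]; exists u => j; rewrite rees_coefE uE coefZ coefXn.
by case: eqP => _; rewrite ?mulr1 ?mulr0.
Qed.

Lemma hcompX d m : hcomp d 'X_[K, m] = if mdeg m == d then 'X_[m] else 0.
Proof. by rewrite -['X_[m]]scale1r hcompZX. Qed.

Lemma mpolyX_eq0 m : ('X_[K, m] == 0) = false.
Proof.
apply/eqP => /(congr1 (mcoeff m)) /eqP.
by rewrite mcoeffX eqxx mcoeff0 oner_eq0.
Qed.

Lemma ideal_exp1_tmon m : tmon Fs m -> 'X_[m] \in ideal_exp I 1.
Proof. by move=> tm; rewrite (ideal_exp_monid 1 IE) /= cats0 monidX. Qed.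

(* The kernels, on the fiber ring, of the identifications of variables that   *)
(* lie in a common [F], until one variable is left in each component, and     *)
(* finally the ideal of elements of positive degree.                          *)
Lemma fiber_prime_chain : exists P : nat -> {pred fiber_ring I},
  let d := (n - #|component_roots Fs|).+1 in
  (forall i, (i <= d)%N -> prime_ideal (P i)) /\
  (forall i, (i < d)%N -> {subset P i <= P i.+1}
                         /\ exists2 x, x \in P i.+1 & x \notin P i).
Proof.
have [phi phiP] := merging_chain Fs; set d := (n - _)%N in phiP *.
pose H0 i (u : rees I) := map_poly (@msub K n (phi i)) (initial_form Fs u).
pose H i u := if (i <= d)%N then H0 i u else ((H0 d u)`_0)%:P.
have H0B i : {morph H0 i : u v / u - v}.
  by move=> u v; rewrite /H0 initial_formB rmorphB.
have H0M i : {morph H0 i : u v / u * v}.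
  by move=> u v; rewrite /H0 (initial_formM IE) rmorphM.
have H01 i : H0 i 1 = 1 by rewrite /H0 initial_form1 rmorph1.
have /choice[P PP] i : exists P : {pred fiber_ring I}, prime_ideal P /\
    forall u, (\pi_({ideal_quot (@fiber_ideal K n I)}) u \in P) = (H i u == 0).
  apply: prime_kernel.
  - move=> u v; rewrite /H; case: ifP => _; first exact: H0B.
    by rewrite H0B coefB rmorphB.
  - move=> u v; rewrite /H; case: ifP => _; first exact: H0M.
    by rewrite H0M coef0M rmorphM.
  - by rewrite /H !H01 coef1 if_same.
  - move=> u uJ; rewrite /H /H0 (initial_form_fiber IE uJ) !rmorph0 coef0 rmorph0.
    by rewrite if_same.
exists P; split=> [i _|i]; first by case: (PP i).
have coefH0 j u k : (H0 j u)`_k = @msub K n (phi j) (hcomp (size Fs * k) (rees_coef u k)).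
  by rewrite /H0 coef_map /= coef_initial_form.
have piE (y : fiber_ring I) : exists u, y = \pi_({ideal_quot (@fiber_ideal K n I)}) u.
  by exists (repr (y : {ideal_quot (@fiber_ideal K n I)})); rewrite reprK.
rewrite ltnS leq_eqVlt => /orP[/eqP ->|ltid]; split.
- move=> y; have [u ->] := piE y; rewrite !(proj2 (PP _)) /H leqnn ltnn.
  by move=> /eqP ->; rewrite coef0 rmorph0.
(* A generator of [I] in degree one has no part of degree zero, yet no substitution kills it. *)
- have [m tm dm] := tmon_exists Fne.
  have [u uE] := rees_monomial (ideal_exp1_tmon tm).
  exists (\pi_({ideal_quot (@fiber_ideal K n I)}) u);
    rewrite (proj2 (PP _)) /H ?ltnn ?leqnn.
    by rewrite coefH0 uE hcomp0 rmorph0 rmorph0.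
  apply/eqP => /(congr1 (fun q : {poly S} => q`_1)) /eqP.
  by rewrite coefH0 uE muln1 hcompX dm eqxx msubX coef0 mpolyX_eq0.
- move=> y; have [u ->] := piE y; rewrite !(proj2 (PP _)) /H ltid (ltnW ltid).
  move=> /eqP Hu0; apply/eqP/polyP => k; rewrite coef0.
  have [F [a [b [_ _ _ _ psiE]]]] := phiP _ ltid.
  rewrite coefH0 psiE -msub_comp.
  have := congr1 (fun q : {poly S} => q`_k) Hu0; rewrite coefH0 coef0 => ->.
  by rewrite rmorph0.
(* The witness is [x_a - x_b] times a monomial [m] for the remaining sets, in degree one: it
   vanishes once [a] and [b] are merged, and not before. *)
- have [F [a [b [FFs aF bF ab psiE]]]] := phiP _ ltid.
  have [|m tm dm] := @tmon_exists (rem F Fs).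
    by move=> G /mem_rem; apply: Fne.
  have tF j : j \in F -> tmon Fs (U_(j) + m).
    move=> jF; rewrite (tmon_perm (perm_to_rem FFs)) -cat1s; apply: tmonD => //.
    by apply/tmon_consP; exists j; rewrite mnm1E eqxx.
  have dF j : mdeg (U_(j) + m)%MM = size Fs.
    by rewrite mdegD mdeg1 dm (perm_size (perm_to_rem FFs)).
  have cI : 'X_[U_(a) + m] - 'X_[U_(b) + m] \in ideal_exp I 1.
    by apply: rpredB; apply/ideal_exp1_tmon/tF.
  have [u uE] := rees_monomial cI.
  have HuE j : @msub K n (phi j) (hcomp (size Fs * 1) (rees_coef u 1)) =
      ('X_(phi j a) - 'X_(phi j b)) * 'X_[mnm_sub (phi j) m].
    by rewrite uE muln1 hcompB !hcompX !dF eqxx rmorphB /= !msubX !mnm_subD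
       !mnm_subU !mpolyXD mulrBl.
  exists (\pi_({ideal_quot (@fiber_ideal K n I)}) u);
    rewrite (proj2 (PP _)) /H ?ltid ?(ltnW ltid).
    apply/eqP/polyP => k; rewrite coefH0 coef0.
    have [->|k1] := eqVneq k 1%N; last by rewrite uE (negPf k1) hcomp0 rmorph0.
    by rewrite HuE psiE /= eqxx eq_sym (negPf ab) subrr mul0r.
  apply/eqP => /(congr1 (fun q : {poly S} => q`_1)) /eqP.
  rewrite coefH0 HuE coef0 mulf_eq0 mpolyX_eq0 orbF subr_eq0 => /eqP.
  move=> /(congr1 (mcoeff U_(phi i a)%MM)); rewrite !mcoeffXU eqxx eq_sym (negPf ab).
  by move/eqP; rewrite oner_eq0.
Qed.

End KrullLower.

(** * Polynomial relations and chains of primes *)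

Section PolynomialRelations.
Variables (K : fieldType) (N : nat).

Section Evaluation.
Variables (R : comNzRingType) (scal : K -> R).

(** Value at [xs] of the polynomial with coefficients [c] and all exponents below [N]. Nesting by
    the first variable matches the induction along a chain of primes. *)
Fixpoint box_eval (xs : seq R) (c : seq 'I_N -> K) : R :=
  if xs is x :: xs' then \sum_(a < N) x ^+ a * box_eval xs' (fun t => c (a :: t))
  else scal (c [::]).

Lemma box_eval0 xs c : scal 0 = 0 ->
  (forall t, size t = size xs -> c t = 0) -> box_eval xs c = 0.
Proof.
move=> s0; elim: xs c => [|x xs IH] c c0 /=; first by rewrite c0.
by rewrite big1 // => a _; rewrite IH ?mulr0 // => t st; rewrite c0 //= st.
Qed.

Lemma big_ord_min_factor (x : R) (Q : 'I_N -> R) (a : 'I_N) :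
  (forall b : 'I_N, (b < a)%N -> Q b = 0) ->
  exists g, \sum_(b < N) x ^+ b * Q b = x ^+ a * (Q a + x * g).
Proof.
move=> Q0; exists (\sum_(b < N | (a < b)%N) x ^+ (b - a.+1) * Q b).
rewrite mulrDr mulrA -exprSr mulr_sumr (bigD1 a) //=; congr (_ + _).
rewrite (bigID (fun b : 'I_N => (a < b)%N)) /= addrC big1 ?add0r.
  apply: eq_big => [b|b /andP[_ ab]]; last by rewrite mulrA -exprD subnKC.
  by case: (ltnP a b) => ab; rewrite ?andbF // andbT -val_eqE gtn_eqF.
move=> b /andP[ba]; rewrite -leqNgt leq_eqVlt => /orP[/eqP/val_inj /eqP|/Q0 ->].
  by rewrite (negPf ba).
by rewrite mulr0.
Qed.

(* If [x_i] lies in [P_{i+1}] but not in [P_i], divide a relation modulo      *)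
(* [P_0] by the least power of [x_0] in it and reduce modulo [P_1].           *)
Lemma prime_chain_independent (P : nat -> {pred R}) xs c :
  scal 0 = 0 -> (forall a, a != 0 -> exists b, b * scal a = 1) ->
  (forall i, (i <= size xs)%N -> prime_ideal (P i)) ->
  (forall i, (i < size xs)%N -> [/\ {subset P i <= P i.+1},
     xs`_i \in P i.+1 & xs`_i \notin P i]) ->
  box_eval xs c \in P 0%N -> forall t, size t = size xs -> c t = 0.
Proof.
move=> s0 sU; elim: xs P c => [|x xs IH] P c Pp Pc /=.
  move=> cP [] // _; apply/eqP; apply: contraT => /sU[b b1].
  have [[P0 P1 Pl] _] := Pp 0%N isT.
  by have := Pl b _ _ cP P0; rewrite addr0 b1 (negPf P1).
have [P01 xP1 xP0] := Pc 0%N isT.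
have [[P0_0 _ P0l] P0p] := Pp 0%N isT; have [[P1_0 _ P1l] _] := Pp 1%N isT.
(* Strong induction on the exponent [a] of [x]: the coefficients of smaller powers already
   vanish. *)
move=> evP [|a t] //= [st]; move: {2}(val a) (leqnn a) t st => k.
elim/ltn_ind: k a => k IHk a; rewrite leq_eqVlt => /orP[/eqP ak|ltak]; last first.
  exact: IHk ltak a (leqnn a).
have [b ba|g gE] := @big_ord_min_factor x (fun a => box_eval xs (fun t => c (a :: t))) a.
  apply: box_eval0 => // t st; apply: (IHk b _ b (leqnn _)) => //.
  by rewrite -ak.
have xaP0 j : x ^+ j \notin P 0%N.
  elim: j => [|j IHj]; first by rewrite expr0; case: (Pp 0%N isT) => -[].
  rewrite exprS; apply/negP => /P0p; by rewrite (negPf IHj) (negPf xP0).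
apply: (IH (P \o S) (fun t => c (a :: t))) => [i lti|i lti|].
- exact: (Pp i.+1).
- exact: (Pc i.+1).
move: evP; rewrite gE => /P0p; rewrite (negPf (xaP0 _)) /= => /P01 QP1.
have := P1l (- g) _ _ xP1 QP1; rewrite mulNr [x * g]mulrC addrCA addNr addr0.
by [].
Qed.

End Evaluation.

Lemma box_eval_morph (R R' : comNzRingType) (scal : K -> R) (scal' : K -> R')
  (h : R -> R') xs c :
  {morph h : u v / u + v} -> {morph h : u v / u * v} -> h 0 = 0 -> h 1 = 1 ->
  (forall a, h (scal a) = scal' a) ->
  h (box_eval scal xs c) = box_eval scal' (map h xs) c.
Proof.
move=> hD hM h0 h1 hs; elim: xs c => [|x xs IH] c //=.
rewrite (big_morph h hD h0); apply: eq_bigr => a _; rewrite hM IH; congr (_ * _).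
by elim: (val a) => [|j IHj]; rewrite ?expr0 // !exprS hM IHj.
Qed.

Lemma box_eval_linear (R : comNzRingType) (scal : {rmorphism K -> R}) xs a c c' :
  box_eval scal xs (fun t => a * c t + c' t) =
  scal a * box_eval scal xs c + box_eval scal xs c'.
Proof.
elim: xs c c' => [|x xs IH] c c' /=; first by rewrite rmorphD rmorphM.
rewrite mulr_sumr -big_split; apply: eq_bigr => i _ /=.
by rewrite IH mulrDr mulrCA.
Qed.

End PolynomialRelations.

Section RelationByCounting.
Variables (K : fieldType) (R : comNzRingType) (scal : {rmorphism K -> R}).

(** There are [N ^ size xs] unknown coefficients and fewer linear conditions, so the kernel is
    nonzero. *)
Lemma box_relation N (xs : seq R) (E : finType) (coord : E -> R -> K) :
  (forall e a u v, coord e (scal a * u + v) = a * coord e u + coord e v) ->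
  (#|E| < N ^ size xs)%N ->
  exists c : seq 'I_N -> K, (exists2 t, size t = size xs & c t != 0) /\
    forall e, coord e (box_eval scal xs c) = 0.
Proof.
move=> coordL ltE; pose T : finType := (size xs).-tuple 'I_N.
pose c (v : 'rV[K]_#|T|) (s : seq 'I_N) :=
  if insub s is Some t then v 0 (enum_rank (t : T)) else 0.
pose f (v : 'rV[K]_#|T|) : 'rV[K]_#|E| :=
  \row_e coord (enum_val e) (box_eval scal xs (c v)).
have fL : linear f.
  move=> a u v; apply/rowP => e; rewrite !mxE -coordL -box_eval_linear.
  congr (coord _ (box_eval _ _ _)); apply/funext => s; rewrite /c.
  by case: insubP => [t _ _|_]; rewrite ?mxE // mulr0 addr0.
pose g : {linear 'rV[K]_#|T| -> 'rV[K]_#|E|} :=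
  HB.pack f (GRing.isLinear.Build _ _ _ _ f fL).
have ker0 : kermx (lin1_mx g) != 0.
  rewrite -mxrank_eq0 mxrank_ker subn_eq0 -ltnNge.
  apply: leq_ltn_trans (rank_leq_col _) _.
  by rewrite card_tuple card_ord.
pose v := nz_row (kermx (lin1_mx g)).
have fv0 : f v = 0.
  have /sub_kermxP := nz_row_sub (kermx (lin1_mx g)); rewrite mul_rV_lin1.
  by [].
exists (c v); split; last first.
  by move=> e; have /rowP/(_ (enum_rank e)) := fv0; rewrite !mxE enum_rankK.
have /rV0Pn[j vj] : v != 0 by rewrite nz_row_eq0.
exists (enum_val j : T); first exact: size_tuple.
by rewrite /c valK enum_valK.
Qed.

End RelationByCounting.

(** * Multidegrees and coordinates of the fiber ring *)

Section BlockDegrees.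
Variables (K : fieldType) (n : nat).
Local Notation S := {mpoly K[n]}.
Implicit Types (m : 'X_{1..n}) (p q : {poly S}).
Variables (Fs : seq {set 'I_n}) (I : ideal S).
Hypothesis IE : I =i monid (tmon Fs).
Hypothesis Fne : {in Fs, forall F, F != set0}.

Definition block (l : 'I_n) : {set 'I_n} := [set i | component Fs i == l].

Definition block_count l := count (fun F : {set 'I_n} => F \subset block l) Fs.

(** The multidegree of elements of the fiber ring: in t-degree [k], each set inside a block
    contributes [k] variables of it. The bound [D] leaves finitely many exponents to count. *)
Definition balanced D q := forall k m, (q`_k)@_m != 0 ->
  (forall l, \sum_(i in block l) m i = k * block_count l)%N /\
  (forall i, m i <= D)%N.

Lemma balancedD D p q : balanced D p -> balanced D q -> balanced D (p + q).
Proof.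
move=> bp bq k m; rewrite coefD mcoeffD => pqm.
have [pm|/bp//] := eqVneq (p`_k)@_m 0.
by apply: bq; rewrite pm add0r in pqm.
Qed.

Lemma balanced0 D : balanced D 0.
Proof. by move=> k m; rewrite coef0 mcoeff0 eqxx. Qed.

Lemma balancedM D D' p q : balanced D p -> balanced D' q -> balanced (D + D') (p * q).
Proof.
move=> bp bq k m; rewrite coefM raddf_sum /= => sm.
have [i /msuppM_split[m1 [m2 [-> /bp[b1 d1] /bq[b2 d2]]]]] :
    exists i : 'I_k.+1, (p`_i * q`_(k - i))@_m != 0.
  apply: contrapT => no; move: sm; rewrite big1 ?eqxx // => i _.
  by apply/eqP; apply: contrapT => /negP ?; apply: no; exists i.
split=> [l|j]; last by rewrite mnmDE leq_add.
under eq_bigr do rewrite mnmDE.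
by rewrite big_split /= b1 b2 -mulnDl subnKC // -ltnS.
Qed.

Lemma balanced_sum D (T : finType) (f : T -> {poly S}) :
  (forall t, balanced D (f t)) -> balanced D (\sum_t f t).
Proof.
move=> bf; apply: (big_ind (balanced D)) => //; first exact: balanced0.
exact: balancedD.
Qed.

Lemma balancedW D D' q : (D <= D')%N -> balanced D q -> balanced D' q.
Proof.
by move=> DD' bq k m /bq[bl bd]; split=> // i; apply: leq_trans DD'.
Qed.

Lemma balancedC D (a : K) : balanced D (a%:MP)%:P.
Proof.
move=> k m; rewrite coefC; case: k => [|k] /=; last by rewrite mcoeff0 eqxx.
rewrite mcoeffC; case: (eqVneq m 0%MM) => [-> _|_]; last by rewrite mulr0 eqxx.
by split=> [l|i]; rewrite ?mnm0E // mul0n big1 // => i _; rewrite mnm0E.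
Qed.

Lemma balancedX D q N : balanced D q -> balanced (N * D) (q ^+ N).
Proof.
move=> bq; elim: N => [|N IH]; first by rewrite expr0 -polyC1 -mpolyC1; apply: balancedC.
by rewrite exprS mulSn; apply: balancedM.
Qed.

Lemma balanced_box_eval D N (xs : seq {poly S}) c :
  (forall x, x \in xs -> balanced D x) ->
  balanced (size xs * (N * D))
    (@box_eval K N _ (fun a => (a%:MP)%:P) xs c).
Proof.
elim: xs c => [|x xs IH] c bxs /=; first exact: balancedC.
apply: balanced_sum => a; rewrite mulSn; apply: balancedM.
  apply: (@balancedW (a * D)); first by rewrite leq_mul2r ltnW ?orbT.
  by apply: balancedX; apply: bxs; rewrite mem_head.
by apply: IH => y ys; apply: bxs; rewrite inE ys orbT.
Qed.

(** A non-empty set lies within a single component, hence inside the block or inside its complement,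
    but not both. *)
Lemma block_countC l :
  (block_count l + count (fun F : {set 'I_n} => F \subset ~: block l) Fs)%N = size Fs.
Proof.
rewrite -(count_predC (fun F : {set 'I_n} => F \subset block l) Fs); congr (_ + _)%N.
apply: eq_in_count => F FFs /=; have /set0Pn[a aF] := Fne FFs.
apply/idP/idP => [/subsetP/(_ a aF)|].
  by rewrite in_setC; apply: contra => /subsetP; apply.
move=> nsub; apply/subsetP => b bF; rewrite in_setC; apply: contra nsub.
rewrite inE => /eqP bl; apply/subsetP => d dF; rewrite inE.
by rewrite (component_eq FFs dF bF) bl.
Qed.

(** [tmon_count] bounds from below the degrees in the block and in its complement. The bounds add up
    to the total degree r k, so both are equalities. *)
Lemma initial_form_balanced (u : rees I) : exists D, balanced D (initial_form Fs u).
Proof.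
pose q := initial_form Fs u.
exists (\max_(k < size q) msize (q`_k))%N => k m qm; split; last first.
  move=> i; have ltk : (k < size q)%N.
    by rewrite ltnNge; apply: contra qm => /(nth_default 0)->; rewrite mcoeff0.
  apply: (leq_trans (n := msize q`_k)); last exact: (leq_bigmax (Ordinal ltk)).
  apply: (leq_trans (n := mdeg m)); first by rewrite mdegE (bigD1 i) //= leq_addr.
  by apply/ltnW/msize_mdeg_lt; rewrite mcoeff_msupp.
move=> l; move: qm; rewrite coef_initial_form hcompE.
case: (eqVneq (mdeg m) (size Fs * k)%N) => [dm|_]; last by rewrite eqxx.
move=> /(ideal_exp_tmon IE (rees_coef_ideal u k)) tm.
have cntE (P : pred {set 'I_n}) : count P (flatten (nseq k Fs)) = (k * count P Fs)%N.
  by rewrite count_flatten map_nseq sumn_nseq mulnC.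
have := tmon_count (block l) tm; have := tmon_count (~: block l) tm.
rewrite !cntE; move: dm; rewrite mdegE (bigID (mem (block l))) /=.
have -> : (\sum_(i in ~: block l) m i = \sum_(i | i \notin block l) m i)%N.
  by apply: eq_bigl => i; rewrite in_setC.
rewrite -(block_countC l) -/(block_count l) mulnDl ![(_ * k)%N]mulnC.
move: (\sum_(_ in _) _)%N (\sum_(_ | _) _)%N (k * _)%N (k * _)%N; lia.
Qed.

End BlockDegrees.

Section BlockCoordinates.
Variables (K : fieldType) (n : nat).
Local Notation S := {mpoly K[n]}.
Variables (Fs : seq {set 'I_n}) (t : 'I_n).
Hypotheses (tcount : (0 < block_count Fs t)%N) (troot : t \in component_roots Fs).

(** The exponent at the root of a block follows from the block degree, so roots are omitted; [t] is
    kept because its block yields [k]. *)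
Definition free_coord : pred 'I_n := fun i => (component Fs i != i) || (i == t).

Lemma card_free_coord : #|[pred i | free_coord i]| = (n - #|component_roots Fs|).+1.
Proof.
have -> : #|[pred i | free_coord i]| = #|t |: ~: component_roots Fs|.
  by apply: eq_card => i; rewrite !inE orbC.
by rewrite cardsU1 in_setC troot /= cardsCs setCK card_ord.
Qed.

Lemma sum_block (f g : 'I_n -> nat) l :
  (forall i, free_coord i -> f i = g i) -> component Fs l = l ->
  (\sum_(i in block Fs l | i != l) f i = \sum_(i in block Fs l | i != l) g i)%N.
Proof.
move=> fg ll; apply: eq_bigr => i /andP[]; rewrite inE => /eqP il ni.
by rewrite fg // /free_coord il eq_sym ni.
Qed.

(* A monomial of the fiber ring is determined by its exponents at the free    *)
(* coordinates: the degree in the block of [t] gives [k], hence the degrees   *)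
(* in the other blocks.                                                       *)
Definition block_degree (f : 'I_n -> nat) : nat :=
  ((\sum_(i in block Fs t) f i) %/ block_count Fs t)%N.

Definition block_monomial (f : 'I_n -> nat) : 'X_{1..n} :=
  [multinom if free_coord i then f i else
    (block_degree f * block_count Fs i - \sum_(j in block Fs i | j != i) f j)%N
   | i < n].

Lemma block_coord_recover D (q : {poly S}) k m (f : 'I_n -> nat) :
  balanced Fs D q -> (q`_k)@_m != 0 -> (forall i, free_coord i -> f i = m i) ->
  block_degree f = k /\ block_monomial f = m.
Proof.
move=> bq qm fm; have [bl _] := bq _ _ qm.
have roott : component Fs t = t by move: troot; rewrite inE => /eqP.
have ft : free_coord t by rewrite /free_coord eqxx orbT.
have tb l : component Fs l = l -> l \in block Fs l by rewrite inE => ->.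
have dk : block_degree f = k.
  rewrite /block_degree (bigD1 t) ?tb //= (sum_block fm) // fm //.
  have := bl t; rewrite (bigD1 t) ?tb //= => ->.
  exact: mulnK.
split=> //; apply/mnmP => i; rewrite mnmE dk; case: ifP => [/fm//|].
rewrite /free_coord => /norP[/negPn/eqP ii _].
by rewrite (sum_block fm) // -(bl i) (bigD1 i) ?tb //= addnK.
Qed.

Definition extend_free D (e : {ffun {i | free_coord i} -> 'I_D.+1}) : 'I_n -> nat :=
  fun i => if insub i is Some j then nat_of_ord (e j) else 0%N.

(** Linear in [q] for every [e], even one that comes from no monomial of the fiber ring; together
    these coordinates separate polynomials balanced with bound [D]. *)
Definition block_coord D (e : {ffun {i | free_coord i} -> 'I_D.+1}) (q : {poly S}) : K :=
  (q`_(block_degree (extend_free e)))@_(block_monomial (extend_free e)).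

Lemma block_coord_eq0 D q : balanced Fs D q ->
  (forall e, @block_coord D e q = 0) -> q = 0.
Proof.
move=> bq q0; apply/polyP => k; apply/mpolyP => m; rewrite coef0 mcoeff0.
apply/eqP; apply: contraT => qm; have [_ mD] := bq _ _ qm.
pose e : {ffun {i | free_coord i} -> 'I_D.+1} := [ffun j => inord (m (val j))].
have eE i : free_coord i -> extend_free e i = m i.
  move=> fi; rewrite /extend_free insubT ffunE /= inordK // ltnS; exact: mD.
have [kE mE] := block_coord_recover bq qm eE.
by have := q0 e; rewrite /block_coord kE mE => qm0; rewrite qm0 eqxx in qm.
Qed.

Lemma block_coord_linear D e (a : K) p q :
  @block_coord D e ((a%:MP)%:P * p + q) = a * block_coord e p + block_coord e q.
Proof. by rewrite /block_coord coefD coefCM mcoeffD mcoeffCM. Qed.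

Lemma balanced_relation (ys : seq {poly S}) :
  (forall y, y \in ys -> exists D, balanced Fs D y) ->
  size ys = (n - #|component_roots Fs|).+2 ->
  exists N (c : seq 'I_N -> K), (exists2 s, size s = size ys & c s != 0) /\
    box_eval (fun a => (a%:MP)%:P) ys c = 0.
Proof.
move=> bys sz.
have [D bD] : exists D, forall y, y \in ys -> balanced Fs D y.
  elim: ys bys {sz} => [|y ys IH] bys; first by exists 0%N.
  have [|D bD] := IH; first by move=> z zs; apply: bys; rewrite inE zs orbT.
  have [D' bD'] := bys y (mem_head _ _).
  exists (maxn D D') => z /[1!inE] /orP[/eqP->|/bD bz].
    exact: balancedW (leq_maxr _ _) bD'.
  exact: balancedW (leq_maxl _ _) bz.
(* There are [N ^ l.+1] unknowns and [D1.+1 ^ l] conditions. As [D1.+1 <= N * B], it is enough that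
   [N] exceed [B ^ l]. *)
pose B := (size ys * D).+1; pose l := (n - #|component_roots Fs|).+1.
pose N := (B ^ l).+1; pose D1 := (size ys * (N * D))%N.
pose scal : {rmorphism K -> {poly S}} := (@polyC S) \o (@mpolyC n K).
have [||c [cn0 c0]] := @box_relation K _ scal N ys _ (@block_coord D1).
  exact: block_coord_linear.
  rewrite card_ffun card_ord card_sig card_free_coord sz -/l expnS.
  apply: (leq_ltn_trans (n := (N * B) ^ l)).
    rewrite leq_exp2r // /D1 /B /N; nia.
  by rewrite expnMn mulnC ltn_pmul2r ?expn_gt0.
exists N, c; split=> //; apply: (block_coord_eq0 (D := D1)) => [|e].
  exact: balanced_box_eval.
exact: c0.
Qed.

End BlockCoordinates.

Section FiberKernel.
Variables (K : fieldType) (n : nat).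
Local Notation S := {mpoly K[n]}.
Implicit Types (m : 'X_{1..n}) (p q : {poly S}).
Variables (Fs : seq {set 'I_n}) (I : ideal S).
Hypothesis IE : I =i monid (tmon Fs).

(** A monomial of I^k whose degree is not r k is a proper multiple of a generator; splitting off a
    variable [x_j] leaves a monomial still in I^k. *)
Lemma initial_form_kernel (u : rees I) : initial_form Fs u = 0 ->
  u \in @fiber_ideal K n I.
Proof.
move=> u0; pose J := @fiber_ideal K n I.
pose P q := exists2 v : rees I, v \in J & rees_val v = q.
have PD p q : P p -> P q -> P (p + q).
  by move=> [v vJ <-] [w wJ <-]; exists (v + w); rewrite ?rpredD ?rees_valD.
have P0 : P 0 by exists 0; rewrite ?rpred0 ?rees_val0.
suff [v vJ vE] : P (rees_val u) by rewrite -(val_inj vE : v = u).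
rewrite -[rees_val u]coefK poly_def; apply: (big_ind P) => // k _.
have uk := rees_coef_ideal u k.
rewrite -rees_coefE [rees_coef u k]mpolyE scaler_suml big_seq.
apply: (big_ind P) => // m; rewrite mcoeff_msupp => um.
have tm := ideal_exp_tmon IE uk um.
have dm : mdeg m != (size Fs * k)%N.
  apply: contra um => dm; have /polyP/(_ k) := u0.
  by rewrite coef_initial_form coef0 => /mpolyP/(_ m); rewrite hcompE dm mcoeff0 => ->.
move: tm; rewrite -[flatten _]cats0 => /tmon_catP[m1 [m2 [mE tm1 _ dm1]]].
have /existsP[j m2j] : [exists j, (0 < m2 j)%N].
  apply: contraR dm => /existsPn m20; rewrite mE (_ : m2 = 0%MM) ?addm0.
    by rewrite dm1 size_flatten_nseq.
  by apply/mnmP => j; rewrite mnm0E; apply/eqP; rewrite -leqn0 leqNgt.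
have [w wE] : exists w : rees I,
    rees_val w = ((rees_coef u k)@_m *: 'X_[m1 + (m2 - U_(j))]) *: 'X^k.
  apply: rees_monomial_val; rewrite (ideal_exp_monid k IE).
  rewrite -mul_mpolyC; apply: (idealPM (monid_idealP K (@tmon_upclosed _ _))).
  by rewrite monidX; apply: tmon_upclosed.
have [x xE] : exists x : rees I, rees_val x = ('X_j : S) *: 'X^0.
  exact: rees_monomial_val.
exists (w * x).
  apply: ideal_absorb; apply: ideal_gen_mem; apply/asboolP.
  by exists 'X_j; [exact: max_idealX|rewrite xE expr0 alg_polyC].
rewrite rees_valM wE xE expr0 alg_polyC mulrC mul_polyC scalerA -scalerAr -mpolyXD.
by rewrite addmA [(U_(j) + m1)%MM]addmC -addmA mnm1K // -mE.
Qed.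

End FiberKernel.

Section AnalyticSpreadFormula.
Local Open Scope quotient_scope.
Variables (K : fieldType) (n : nat).
Local Notation S := {mpoly K[n]}.
Variables (Fs : seq {set 'I_n}) (I : ideal S).
Hypothesis IE : I =i monid (tmon Fs).
Hypotheses (Fs0 : Fs != [::]) (Fne : {in Fs, forall F, F != set0}).
Local Notation J := (@fiber_ideal K n I).

Lemma rees_scalars : exists scal : K -> rees I,
  [/\ scal 0 = 0, forall a, a != 0 -> exists b, b * scal a = 1
    & forall a, initial_form Fs (scal a) = (a%:MP)%:P].
Proof.
have /choice[scal scalE] (a : K) : exists u : rees I, rees_val u = (a%:MP)%:P.
  have [u uE] := @rees_monomial_val _ _ I 0%N a%:MP isT.
  by exists u; rewrite uE expr0 alg_polyC.
exists scal; split=> [|a a0|a].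
- by apply: val_inj; rewrite [LHS]scalE [RHS]rees_val0 !rmorph0.
- exists (scal a^-1); apply: val_inj.
  by rewrite [LHS]rees_valM !scalE [RHS]rees_val1 -!rmorphM mulVf // !rmorph1.
- apply/polyP => k; rewrite coef_initial_form rees_coefE scalE !coefC.
  case: k => [|k]; last by rewrite hcomp0.
  apply/mpolyP => m; rewrite hcompE muln0 mdeg_eq0 mcoeffC.
  by case: eqVneq => // _; rewrite mulr0.
Qed.

Lemma fiber_prime_chain_bound (P : nat -> {pred fiber_ring I}) e :
  (forall i, (i <= e)%N -> prime_ideal (P i)) ->
  (forall i, (i < e)%N -> {subset P i <= P i.+1}
                       /\ exists2 x, x \in P i.+1 & x \notin P i) ->
  (e <= (n - #|component_roots Fs|).+1)%N.
Proof.
move=> Pp Pc; rewrite leqNgt; apply/negP; set l := (n - _).+1 => ltle.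
have [F0 F0Fs] : exists F, F \in Fs.
  by case: (Fs) Fs0 => // F ? _; exists F; rewrite mem_head.
have /set0Pn[a0 a0F] := Fne F0Fs.
pose t := component Fs a0.
have troot : t \in component_roots Fs by rewrite inE /t component_id eqxx.
have tcount : (0 < block_count Fs t)%N.
  rewrite -has_count; apply/hasP; exists F0 => //; apply/subsetP => b bF.
  by rewrite inE /t (component_eq F0Fs bF a0F).
pose piJ (u : rees I) : fiber_ring I := \pi_({ideal_quot J}) u.
have /choice[x xP] i : exists u : rees I,
    (i < e)%N -> piJ u \in P i.+1 /\ piJ u \notin P i.
  case: (ltnP i e) => [/Pc[_ [y y1 y0]]|_]; last by exists 0.
  by exists (repr (y : {ideal_quot J})); rewrite /piJ reprK.
(* A chain of more than [l] steps would make these [l + 1] elements algebraically independent, yet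
   their initial forms satisfy a relation. *)
pose xs := mkseq x l.+1; have sxs : size xs = l.+1 by rewrite size_mkseq.
have [N [c [[s ss cs] rel]]] :
    exists N (c : seq 'I_N -> K), (exists2 s, size s = l.+1 & c s != 0) /\
      box_eval (fun a => (a%:MP)%:P) (map (@initial_form K n Fs I) xs) c = 0.
  have [y||N [c cP]] := balanced_relation tcount troot (ys := map (@initial_form K n Fs I) xs).
  - by case/mapP=> u _ ->; apply: (initial_form_balanced IE).
  - by rewrite size_map sxs.
  by exists N, c; rewrite size_map sxs in cP.
have [scal [scal0 scalU scalE]] := rees_scalars.
(* The chain is pulled back to the Rees algebra, where the relation evaluates into [J], and so into
   [Q 0]. *)
pose Q i : {pred rees I} := [pred u | piJ u \in P i].
apply/negP: cs; rewrite negbK; apply/eqP.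
apply: (@prime_chain_independent K N _ scal Q xs) => //; last by rewrite sxs.
- move=> i; rewrite sxs => lei.
  have [[P0 P1 Pl] Pm] := Pp i (leq_trans lei ltle).
  split; first split.
  + by rewrite inE /= /piJ rmorph0.
  + by rewrite inE /= /piJ rmorph1.
  + by move=> a u v; rewrite !inE /= /piJ rmorphD rmorphM; apply: Pl.
  + by move=> u v; rewrite !inE /= /piJ rmorphM; apply: Pm.
- move=> i; rewrite sxs => lti; have ltie := leq_trans lti ltle.
  rewrite nth_mkseq //; have [x1 x0] := xP i ltie; split=> //.
  by move=> u; rewrite !inE /=; apply: (proj1 (Pc i ltie)).
- rewrite inE /=.
  have : box_eval scal xs c \in J.
    apply: (initial_form_kernel IE).
    rewrite (@box_eval_morph K N _ _ scal (fun a => (a%:MP)%:P) (@initial_form K n Fs I)) //.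
    + exact: initial_formD.
    + exact: (initial_formM IE).
    + exact: initial_form0.
    + exact: initial_form1.
  have -> u : (u \in J) = (piJ u == 0).
    by rewrite -[u in u \in J]subr0 Quotient.idealrBE /piJ rmorph0.
  by move=> /eqP->; have [[]] := Pp 0%N isT.
Qed.

Theorem analytic_spread_transversal :
  analytic_spread I = (n - #|component_roots Fs|).+1.
Proof.
apply: nat_sup_max; first exact: (fiber_prime_chain IE Fne).
by move=> e [P [Pp Pc]]; apply: fiber_prime_chain_bound Pp Pc.
Qed.

End AnalyticSpreadFormula.

(* Depth of the powers, its limit, and the analytic spread *)
From mathcomp Require Import classical_sets filter nat_topology.
Local Open Scope classical_set_scope.
Local Open Scope ring_scope.

Theorem corollary3p14 (K : fieldType) (n : nat) (I : ideal {mpoly K[n]})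
    (hI : transversal_polymatroidal I) :
  [/\ forall k : nat, (1 <= k)%N -> depth_quot I = depth_quot (ideal_exp I k),
      (fun k : nat => depth_quot (ideal_exp I k)) @ \oo --> depth_quot I
    & (analytic_spread I)%:Z = n%:Z - (depth_quot I)%:Z].
Proof.
have [Fs [Fs0 Fne IFs]] := hI.
have IE : I =i monid (tmon Fs) by move=> p; rewrite IFs transversal_product_monid.
have depthE := depth_transversal IE Fs0 Fne.
have depth_exp k : (1 <= k)%N -> depth_quot I = depth_quot (ideal_exp I k).
  (* For [k >= 1], repeating the list of sets changes neither its members nor the components. *)
  move=> k1; have memk F : (F \in flatten (nseq k Fs)) = (F \in Fs).
    apply/flattenP/idP => [[_ /nseqP[-> _]//]|FFs].
    by exists Fs; rewrite // mem_nseq k1 eqxx.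
  rewrite depthE (depth_transversal (ideal_exp_monid k IE)).
  - congr (#|pred_of_set _|.-1); apply/setP => a; rewrite !inE.
    by rewrite (eq_component (Gs := Fs)).
  - apply: contraNneq Fs0 => Fsk0; case defFs: Fs => [|F Gs] //.
    by have := memk F; rewrite Fsk0 defFs mem_head.
  - by move=> F; rewrite memk; apply: Fne.
(* The sequence is constant from [k = 1] on; [k = 0], where the power is the whole ring, is left
   out. *)
split=> //.
  apply: topology_structure.cvg_near_cst; apply: filterS (nbhs_infty_gt 0) => k k0.
  by rewrite -depth_exp.
rewrite (analytic_spread_transversal IE Fs0 Fne) depthE.
(* The number of components is between 1 and n, so the truncated subtractions in both formulas are
   exact. *)
have C0 : (0 < #|component_roots Fs|)%N.
  case: (Fs) Fs0 Fne => // F Gs _ /(_ F (mem_head _ _)) /set0Pn[a _].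
  by apply/card_gt0P; exists (component (F :: Gs) a); rewrite inE component_id.
have := max_card (component_roots Fs); rewrite card_ord.
lia.
Qed.
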